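(* Let $X$, $Y$ and $Z$ be real random variables for which the marginal kernels exist, i.e. $h_{F_1}$, $h_{F_2}$ and $h_F$ exist, where $F_1,F_2,F$ are the distribution functions of $X,Y,Z$ respectively. Then: (1) If $a$, $b$, $c$ and $d$ are constants, then $\kappa(aX+b,cY+d)=|a|\,|c|\,\kappa(X,Y)$ and $\rho^*(aX+b,cY+d)=\rho^*(X,Y)$. (2) $\kappa(X,Y)\ge 0$, with equality if and only if $X$ and $Y$ are independent. (3) If $\kappa(X,X)<\infty$ and $\kappa(Y,Y)<\infty$, then $\kappa(X,Y)\le\sqrt{\kappa(X,X)\kappa(Y,Y)}$, with equality if and only if $X$ and $Y$ are almost surely linearly related. (4) If both $X$ and $Y$ are dichotomous, then $\kappa(X,Y)=\mathrm{cov}(X,Y)^2$ and $\rho^*(X,Y)=\rho(X,Y)^2$. (5) With $Z_{i:n}$ the $i$th order statistic in an i.i.d. sample of size $n$ from the distribution of $Z$, $\kappa(Z,Z)=\frac16E(Z_{2:4}-Z_{3:4})^2$.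
   Context: For a real random variable $Z$ its distribution function is taken in the convention $F(z)=P(Z<z)+\tfrac12P(Z=z)$; no restriction is placed on distributions (continuous, discrete or mixed). With $Z_1,Z_2$ i.i.d. with distribution function $F$, define $$h_F(z_1,z_2)=-\tfrac12E\big(|z_1-z_2|-|z_1-Z_2|-|Z_1-z_2|+|Z_1-Z_2|\big).$$ The kernel $h_F$ is said to exist if $h_F(z_1,z_2)$ is finite for some $(z_1,z_2)\in\mathbb R^2$. For real random variables $X,Y$ with marginal distribution functions $F_1,F_2$ and with $(X_1,Y_1),(X_2,Y_2)$ i.i.d. copies of $(X,Y)$, $$\kappa(X,Y)=E\,h_{F_1}(X_1,X_2)h_{F_2}(Y_1,Y_2),\qquad \rho^*(X,Y)=\frac{\kappa(X,Y)}{\sqrt{\kappa(X,X)\kappa(Y,Y)}}.$$ In particular $\kappa(X,X)=Eh_{F_1}(X_1,X_2)^2$. $\mathrm{cov}$ and $\rho$ denote the ordinary covariance and correlation. A random variable is dichotomous if it takes only two values with probability one. ''$X$ and $Y$ are almost surely linearly related'' means that one of them is almost surely equal to an affine function of the other.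
   Formalization: In (1) invariance of ρ* is for a,c≠0 (else 0/0); in (2) κ≥0 is claimed when the expectation defining κ exists in [-∞,+∞]; in (4) the false κ=cov² is corrected to |u-v||u'-v'|κ=cov² for X in {u,v}, Y in {u',v'}, giving κ=cov² for values one unit apart. *)

(* Defs.v *)
From HB Require Import structures.
From mathcomp Require Import all_boot all_order all_algebra.
From mathcomp Require Import all_classical all_reals all_analysis.
From mathcomp Require Import measurable_realfun.

Set Implicit Arguments.
Unset Strict Implicit.
Unset Printing Implicit Defensive.

Import Order.TTheory GRing.Theory Num.Theory.
Import numFieldNormedType.Exports.

Local Open Scope classical_set_scope.
Local Open Scope ring_scope.
Local Open Scope ereal_scope.

(* The kernel h_F is indexed by the law mu with distribution function F:
   z |-> mu {x < z} + mu {z} / 2 determines mu, and h_F depends on F only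
   through i.i.d. variables Z1, Z2 with law mu, taken here to be the two
   coordinates under mu \x mu.  The integrand is at most 2 * |z1 - z2|, so the
   expectation always exists in [-oo, +oo[. *)
Definition hker (R : realType) (mu : probability R R) (z1 z2 : R) : \bar R :=
  (- 2^-1)%:E * 'E_(mu \x mu)[fun z : R * R =>
    (`|z1 - z2| - `|z1 - z.2| - `|z.1 - z2| + `|z.1 - z.2|)%R].

Definition hker_exists (R : realType) (mu : probability R R) : Prop :=
  exists z : R * R, hker mu z.1 z.2 \is a fin_num.

Section kappa.
Context d (T : measurableType d) (R : realType) (P : probability T R).
Implicit Types X Y : {RV P >-> R}.

(* (X1, Y1) and (X2, Y2) are the copies of (X, Y) on the two factors of
   P \x P. *)
Definition kappa_integrand X Y (w : T * T) : \bar R :=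
  hker (distribution P X) (X w.1) (X w.2) *
  hker (distribution P Y) (Y w.1) (Y w.2).

Definition kappa X Y : \bar R := \int[P \x P]_w kappa_integrand X Y w.

(* The expectation defining kappa X Y exists in [-oo, +oo], i.e., its positive
   and negative parts are not both infinite.  Existence of the two kernels does
   not imply this. *)
Definition kappa_defined X Y : bool :=
  \int[P \x P]_w (kappa_integrand X Y)^\+ w +?
  - \int[P \x P]_w (kappa_integrand X Y)^\- w.

(* 0 if X or Y is constant, as is correlation. *)
Definition rho_star X Y : \bar R :=
  kappa X Y / sqrte (kappa X X * kappa Y Y).

Definition correlation X Y : \bar R :=
  covariance P X Y / sqrte ('V_P[X] * 'V_P[Y]).

Definition independent2 X Y : Prop :=
  forall A B : set R, measurable A -> measurable B ->
    P (X @^-1` A `&` Y @^-1` B) = P (X @^-1` A) * P (Y @^-1` B).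

Definition linearly_related X Y : Prop :=
  (exists a b : R, {ae P, forall w, Y w = (a * X w + b)%R}) \/
  (exists a b : R, {ae P, forall w, X w = (a * Y w + b)%R}).

Definition dichotomous_at X (u v : R) : Prop :=
  u != v /\ P (X @^-1` [set u; v]) = 1.

(* Taking some of the B i to be setT gives the product rule for every
   subfamily. *)
Definition iid_sample n (mu : probability R R) (S : 'I_n -> {RV P >-> R}) :
    Prop :=
  (forall i (A : set R), measurable A -> distribution P (S i) A = mu A) /\
  (forall B : 'I_n -> set R, (forall i, measurable (B i)) ->
    P (\bigcap_i (S i @^-1` B i)) = \prod_(i < n) P (S i @^-1` B i)).

End kappa.

Arguments kappa_integrand {d T R} P X Y w.
Arguments kappa {d T R} P X Y.
Arguments kappa_defined {d T R} P X Y.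
Arguments rho_star {d T R} P X Y.
Arguments correlation {d T R} P X Y.
Arguments independent2 {d T R} P X Y.
Arguments linearly_related {d T R} P X Y.
Arguments dichotomous_at {d T R} P X u v.
Arguments iid_sample {d T R} P {n} mu S.

Definition affine d (T : measurableType d) (R : realType) (a b : R)
  (X : {mfun T >-> R}) : {mfun T >-> R} := (cst a \* X \+ cst b)%R.

(* Z_{i:n}, for 1 <= i <= n. *)
Definition order_stat T (R : realType) n (S : 'I_n -> T -> R) (i : nat)
  (w : T) : R := nth 0%R (sort <=%R [seq S j w | j <- enum 'I_n]) i.-1.

(* Main.v *)
Require Import Defs.
From HB Require Import structures.
From mathcomp Require Import all_boot all_order all_algebra.
From mathcomp Require Import all_classical all_reals all_analysis.
From mathcomp Require Import measurable_realfun ring lra.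

Set Implicit Arguments.
Unset Strict Implicit.
Unset Printing Implicit Defensive.

Import Order.TTheory GRing.Theory Num.Theory.
Import numFieldNormedType.Exports.

Local Open Scope classical_set_scope.
Local Open Scope ring_scope.
Local Open Scope ereal_scope.

(** Let a(x, s) = 1{x <= s} - F(s) be the step at x centred by the right
continuous distribution function F.  The squared L2(ds) distance of two steps is
the length |x - z| of the interval between them, so the combination of four
distances that defines h_F polarizes: h_F(x, z) is the inner product in L2(ds)
of a(x, .) and a(z, .), and h_F(x, x) is the squared norm of a(x, .)
([hker_diag], [hkerE_hnorm], [hker_gram]).  Existence of the kernel at one point
makes all these norms finite.  Hence the integrand h_F1(X1, X2) h_F2(Y1, Y2) of
kappa(X, Y) is the Gram kernel of the vectors (s, t) |-> a_X(X, s) a_Y(Y, t) of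
L2 of the plane, whose mean is the gap g = F12 - F1 F2 between the joint
distribution function and the product of the marginal ones.  Exchanging the
integrals gives the formula behind everything,

    kappa(X, Y) = integral over the plane of g(s, t)^2 ds dt.

The integrals cannot be exchanged blindly, because the integrand of kappa need
not be integrable.  Truncating to points whose feature has bounded norm and
passing to the limit gives the integral of g^2 as a lower bound of kappa, under
the sole assumption that the positive part of the integrand is integrable
([gram_lower]); equality holds when the squared first absolute moments of the
features are integrable ([gram_eq]), and for nonnegative integrands as soon as
these moments are controlled by the means ([gram_eq_ge0]).

An affine map multiplies distances, hence h, by |a|.

The lower bound gives kappa >= 0.  If kappa = 0 then g vanishes almost everywhere, so everywhere
by right continuity ([cdf_gap_ae0]), and a joint distribution function that
factors means independence.  Under independence g is zero and the equality case
applies.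

The bound by the geometric mean is the Cauchy-Schwarz inequality in
L2(P x P).  In the case of equality the kernels of X and Y are proportional
almost surely; being Lipschitz, they are proportional at all pairs of points of
the support of the law of (X, Y) ([typical_eq0]).  Their diagonal terms then
cancel and leave b |x - x'| = a |y - y'| on the support, which forces an affine
relation ([affine_of_similarity]).

For points of a two-point set {u, v} the combination of four distances is
-2 (x - z1) (y - z2) / |u - v| ([four_point_dichotomous]), so h_F is a normalized
product of deviations from the mean.

The gap between the second and the third of four sample values is the integral
over s of the indicator that exactly two of them are at most s.  Its square is a double integral over (s, t), in which the same two
values have to be at most s and at most t; by independence, and summing over the
6 pairs, its expectation is 6 (F(min) (1 - F(max)))^2, and F(min) (1 - F(max)) is
the gap g of the pair (Z, Z). *)

(** * Products and squares of measures *)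

Lemma integral_prod_mul d1 d2 (T1 : measurableType d1) (T2 : measurableType d2)
    (R : realType) (m1 : {sigma_finite_measure set T1 -> \bar R})
    (m2 : {sigma_finite_measure set T2 -> \bar R}) (f : T1 -> R) (g : T2 -> R) :
  m1.-integrable setT (EFin \o f) -> m2.-integrable setT (EFin \o g) ->
  (m1 \x m2).-integrable setT (fun z => (f z.1 * g z.2)%:E) /\
  \int[m1 \x m2]_z (f z.1 * g z.2)%:E =
    \int[m1]_x (f x)%:E * \int[m2]_y (g y)%:E.
Proof.
move=> fi gi.
have mf : measurable_fun setT f by apply/measurable_EFinP; exact: measurable_int fi.
have mg : measurable_fun setT g by apply/measurable_EFinP; exact: measurable_int gi.
have mfg : measurable_fun setT (fun z : T1 * T2 => (f z.1 * g z.2)%:E).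
  apply/measurable_EFinP; apply: measurable_funM.
  - exact: measurableT_comp.
  - exact: measurableT_comp.
have fgi : (m1 \x m2).-integrable setT (fun z => (f z.1 * g z.2)%:E).
  apply/(integrable12ltyP m1 m2 mfg).
  under eq_integral => x _.
    under eq_integral => y _ do rewrite /= normrM EFinM.
    rewrite ge0_integralZl//; last first.
      by apply/measurable_EFinP; exact: measurableT_comp.
    over.
  rewrite /= ge0_integralZr//; last 2 first.
  - by apply/measurable_EFinP; exact: measurableT_comp.
  - exact: integral_ge0.
  apply: lte_mul_pinfty.
  - exact: integral_ge0.
  - by move/integrableP : fi => [_ fi]; rewrite ge0_fin_numE ?integral_ge0.
  - by move/integrableP : gi => [_ gi].
split=> //.
rewrite -integral12_prod_meas1// /fubini_F.
under eq_integral => x _.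
  under eq_integral => y _ do rewrite /= EFinM.
  rewrite integralZl//.
  rewrite -[X in _ * X]fineK; last exact: integrable_fin_num.
  over.
rewrite integralZr// fineK//; exact: integrable_fin_num.
Qed.

Section square_measure.
Context d (T : measurableType d) (R : realType).

(** The ascription makes the integrals over [T * T] integrals against a
probability. *)
Definition psquare (P : probability T R) : probability (T * T)%type R := P \x P.

Variable L : {sigma_finite_measure set T -> \bar R}.

Let sigma_finite_square : sigma_finite setT (L \x L).
Proof.
have /sigma_finiteP[F [TF ndF Foo]] := sigma_finiteT L.
exists (fun n => F n `*` F n).
  rewrite -setXTT TF predeqE => -[x y]; split.
    move=> [/= [n _ Fnx] [k _ Gky]]; exists (maxn n k) => //; split.
    - by move: x Fnx; exact/subsetPset/ndF/leq_maxl.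
    - by move: y Gky; exact/subsetPset/ndF/leq_maxr.
  by move=> [n _ []/= ? ?]; split; exists n.
move=> k; have [? ?] := Foo k.
split; first exact: measurableX.
by rewrite product_measure1E// lte_mul_pinfty// ge0_fin_numE.
Qed.

(** [L \x L] packed with its sigma-finiteness, which Fubini's theorem requires
when this product is in turn one of the two factors. *)
Definition msquare : {sigma_finite_measure set (T * T)%type -> \bar R} :=
  HB.pack (L \x L)
    (Measure_isSigmaFinite.Build _ _ _ (L \x L) sigma_finite_square).

End square_measure.

(** * Gram kernels *)

(** A map [A : T * S -> R] is seen as a random vector [A (w, .)] of L2(L), with [w]
drawn from [P]; [gram A] is the inner product of two independent copies and
[mean_feature A] the mean vector.  Formally the mean of the inner product is the
squared norm of the mean vector; the results below say when this is true. *)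
Section gram.
Context d d' (T : measurableType d) (S : measurableType d') (R : realType).
Variables (P : probability T R) (L : {sigma_finite_measure set S -> \bar R}).
Implicit Type A : T * S -> R.

Definition gram A (w : T * T) : \bar R :=
  \int[L]_s (A (w.1, s) * A (w.2, s))%:E.

Definition gram_integrand A (p : (T * T) * S) : \bar R :=
  (A (p.1.1, p.2) * A (p.1.2, p.2))%:E.

Definition mean_feature A (s : S) : R := Rintegral P setT (fun w => A (w, s)).

Lemma measurable_gram_integrand A : measurable_fun setT A ->
  measurable_fun setT (gram_integrand A).
Proof.
move=> mA; apply/measurable_EFinP; apply: measurable_funM.
- apply: (measurableT_comp mA); apply: measurable_fun_pair => //.
  exact: (measurableT_comp measurable_fst measurable_fst).
- apply: (measurableT_comp mA); apply: measurable_fun_pair => //.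
  exact: (measurableT_comp measurable_snd measurable_fst).
Qed.

Lemma measurable_gram A : measurable_fun setT A -> measurable_fun setT (gram A).
Proof.
move=> mA; have mG := measurable_gram_integrand mA.
rewrite (_ : gram A = fun w : T * T =>
   \int[L]_s (gram_integrand A)^\+ (w, s) - \int[L]_s (gram_integrand A)^\- (w, s)).
  apply: emeasurable_funB.
  - by apply: (@measurable_fun_fubini_tonelli_F _ _ _ _ _ L (gram_integrand A)^\+) => //;
      exact: measurable_funepos.
  - by apply: (@measurable_fun_fubini_tonelli_F _ _ _ _ _ L (gram_integrand A)^\-) => //;
      exact: measurable_funeneg.
by apply/funext => w; rewrite [LHS]integralE; congr (_ - _);
  apply: eq_integral => s _; rewrite ?funeposE ?funenegE.
Qed.

Lemma gram_fubini A : measurable_fun setT A ->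
  (forall s, P.-integrable setT (fun w => (A (w, s))%:E)) ->
  (psquare P \x L).-integrable setT (gram_integrand A) ->
  (psquare P).-integrable setT (gram A) /\
  \int[psquare P]_w gram A w = \int[L]_s (mean_feature A s ^+ 2)%:E.
Proof.
move=> mA iA iG; split; first exact: (integrable_fubini_F iG).
rewrite (integral12_prod_meas1 iG) -(integral21_prod_meas1 iG).
apply: eq_integral => s _ /=; rewrite /fubini_G.
have [_ ->] := integral_prod_mul (iA s) (iA s).
by rewrite /mean_feature /Rintegral expr2 EFinM fineK//; exact: integrable_fin_num (iA s).
Qed.

Lemma measurable_section2 A w : measurable_fun setT A ->
  measurable_fun setT (fun s => A (w, s)).
Proof. by move=> mA; apply: (measurableT_comp mA); exact: pair1_measurable. Qed.

Lemma measurable_mean_feature A : measurable_fun setT A ->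
  (forall s, P.-integrable setT (fun w => (A (w, s))%:E)) ->
  measurable_fun setT (mean_feature A).
Proof.
move=> mA iA; have mE : measurable_fun setT (EFin \o A) by exact/measurable_EFinP.
rewrite (_ : mean_feature A = fun s =>
   (fine (\int[P]_w (EFin \o A)^\+ (w, s)) - fine (\int[P]_w (EFin \o A)^\- (w, s)))%R).
  apply: measurable_funB; apply: measurableT_comp => //.
  - by apply: (@measurable_fun_fubini_tonelli_G _ _ _ _ _ P (EFin \o A)^\+) => //;
      exact: measurable_funepos.
  - by apply: (@measurable_fun_fubini_tonelli_G _ _ _ _ _ P (EFin \o A)^\-) => //;
      exact: measurable_funeneg.
apply/funext => s; rewrite /mean_feature /Rintegral integralE fineB.
- by congr (_ - _)%R; congr fine; apply: eq_integral => w _; rewrite ?funeposE ?funenegE.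
- exact: integrable_pos_fin_num (iA s).
- exact: integrable_neg_fin_num (iA s).
Qed.

(** The inner product of two vectors is at most half the sum of their squared
norms, which is bounded here by [C]. *)
Lemma gram_integrand_bounded A (C : R) : measurable_fun setT A ->
  (forall w, \int[L]_s (A (w, s) ^+ 2)%:E <= C%:E) ->
  (psquare P \x L).-integrable setT (gram_integrand A).
Proof.
move=> mA AC; have mG := measurable_gram_integrand mA.
apply/(integrable12ltyP _ _ mG).
apply: (@le_lt_trans _ _ (\int[psquare P]_w (cst C%:E w))); last first.
  by rewrite integral_cst// -[X in X < _]fineK ?ltry//
    fin_numM// fin_num_measure.
apply: ge0_le_integral => //.
- by move=> w _; exact: integral_ge0.
- apply: (@measurable_fun_fubini_tonelli_F _ _ _ _ _ L (abse \o gram_integrand A)) => //.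
  exact: measurableT_comp.
- by move=> w; exact: abse_ge0.
move=> [w1 w2] _ /=.
have mA1 w : measurable_fun setT (fun s => (A (w, s) ^+ 2)%:E).
  apply/measurable_EFinP; apply: (@measurable_funX _ _ _ _ (fun s => A (w, s))).
  exact: measurable_section2.
apply: (@le_trans _ _ (\int[L]_s ((2^-1)%:E * ((A (w1, s) ^+ 2)%:E + (A (w2, s) ^+ 2)%:E)))).
  apply: ge0_le_integral => //.
  - apply: (@measurableT_comp _ _ _ _ _ _ (fun p => `|gram_integrand A p|) _
      (fun s => ((w1, w2), s))).
      exact: measurableT_comp.
    exact: pair1_measurable.
  - by apply: emeasurable_funM => //; exact: emeasurable_funD.
  - move=> s _; rewrite -EFinD -EFinM lee_fin /=.
    set x := A _; set y := A _; rewrite normrM.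
    rewrite -(real_normK (num_real x)) -(real_normK (num_real y)).
    by have := sqr_ge0 (`|x| - `|y|)%R; nra.
rewrite ge0_integralZl//; last 2 first.
- by apply: emeasurable_funD.
- by move=> s _; rewrite -EFinD lee_fin addr_ge0// sqr_ge0.
rewrite ge0_integralD//; last 2 first.
- by move=> s _; rewrite lee_fin sqr_ge0.
- by move=> s _; rewrite lee_fin sqr_ge0.
have -> : C%:E = (2^-1)%:E * (C%:E + C%:E).
  by rewrite -EFinD -EFinM; congr EFin; lra.
by rewrite lee_pmul2l//; exact: leeD.
Qed.

(** By independence of the two copies, the mean over [psquare P] of the absolute
integrand at [s] is the square of the first absolute moment at [s]. *)
Lemma gram_integrand_mean A : measurable_fun setT A ->
  \int[L]_s ((\int[P]_w `|A (w, s)|%:E) ^+ 2) < +oo ->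
  (forall s, P.-integrable setT (fun w => (A (w, s))%:E)) ->
  (psquare P \x L).-integrable setT (gram_integrand A).
Proof.
move=> mA fin iA; have mG := measurable_gram_integrand mA.
apply/(integrable21ltyP _ _ mG); apply: le_lt_trans fin.
rewrite le_eqVlt; apply/orP; left; apply/eqP; apply: eq_integral => s _.
under eq_integral => w _ do rewrite /gram_integrand /= normrM.
have iAs : P.-integrable setT (EFin \o (fun w => `|A (w, s)|%R)).
  by have := integrable_abse (iA s).
by have [_ ->] := integral_prod_mul iAs iAs; rewrite expe2.
Qed.

End gram.

Lemma fatou_cvg d (T : measurableType d) (R : realType)
    (mu : {measure set T -> \bar R}) (f_ : (T -> \bar R)^nat) (f : T -> \bar R)
    (l : \bar R) :
  (forall n, measurable_fun setT (f_ n)) -> (forall n x, 0 <= f_ n x) ->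
  (forall x, f_ ^~ x @ \oo --> f x) ->
  \int[mu]_x f_ n x @[n --> \oo] --> l -> \int[mu]_x f x <= l.
Proof.
move=> mf f0 ff fl.
have := fatou mu measurableT mf (fun n x _ => f0 n x).
rewrite (cvg_limn_einf_sup fl).1.
by under eq_integral => x _ do rewrite (cvg_limn_einf_sup (ff x)).1.
Qed.

Lemma fatou_le d (T : measurableType d) (R : realType)
    (mu : {measure set T -> \bar R}) (f_ : (T -> \bar R)^nat) (f : T -> \bar R)
    (C : \bar R) :
  (forall n, measurable_fun setT (f_ n)) -> (forall n x, 0 <= f_ n x) ->
  (forall x, f_ ^~ x @ \oo --> f x) ->
  (forall n, \int[mu]_x f_ n x <= C) -> \int[mu]_x f x <= C.
Proof.
move=> mf f0 ff fC.
have := fatou mu measurableT mf (fun n x _ => f0 n x).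
under eq_integral => x _ do rewrite (cvg_limn_einf_sup (ff x)).1.
move=> /le_trans; apply; rewrite limn_einf_lim.
apply: lime_le; first exact: is_cvg_einfs.
apply: nearW => n; apply: le_trans (fC n).
by apply: ereal_inf_lbound; exists n => /=.
Qed.

Section gram_kernel.
Context d d' (T : measurableType d) (S : measurableType d') (R : realType).
Variables (P : probability T R) (L : {sigma_finite_measure set S -> \bar R}).
Variable A : T * S -> R.
Hypothesis mA : measurable_fun setT A.
Hypothesis iA : forall s, P.-integrable setT (fun w => (A (w, s))%:E).
Hypothesis A2 : forall w, L.-integrable setT (fun s => (A (w, s) ^+ 2)%:E).

Let K := gram L A.

Lemma integrable_featureM w1 w2 :
  L.-integrable setT (fun s => (A (w1, s) * A (w2, s))%:E).
Proof.
have := integrableD measurableT (A2 w1) (A2 w2).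
apply: le_integrable => //.
  apply/measurable_EFinP; apply: measurable_funM; exact: measurable_section2.
move=> s _; rewrite lee_fin.
rewrite [leRHS]ger0_norm ?addr_ge0 ?sqr_ge0//.
set x := A _; set y := A _; rewrite normrM.
rewrite -(real_normK (num_real x)) -(real_normK (num_real y)).
by have := sqr_ge0 (`|x| - `|y|)%R; nra.
Qed.

Lemma gram_fin_num w : gram L A w \is a fin_num.
Proof. exact: integrable_fin_num (integrable_featureM w.1 w.2). Qed.

Lemma gram_diag_ge0 w : 0 <= gram L A (w, w).
Proof. by apply: integral_ge0 => s _; rewrite lee_fin -expr2 sqr_ge0. Qed.

(** Cutting the feature to zero outside [small n] bounds its norm and only replaces
some values of the Gram kernel by zero. *)
Let small n : set T := [set w | K (w, w) <= n%:R%:E].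

Let measurable_small n : measurable (small n).
Proof.
rewrite -[small n]setTI; apply: emeasurable_fun_infty_c => //.
apply: (@measurableT_comp _ _ _ _ _ _ K _ (fun w => (w, w))).
  exact: measurable_gram.
exact: measurable_fun_pair.
Qed.

Let cut n (p : T * S) : R := (\1_(small n) p.1 * A p)%R.

Let measurable_cut n : measurable_fun setT (cut n).
Proof.
apply: measurable_funM => //.
by apply: (@measurableT_comp _ _ _ _ _ _ (\1_(small n) : T -> R)).
Qed.

Let cut_le n p : (`|cut n p| <= `|A p|)%R.
Proof.
rewrite /cut normrM indicE; case: (_ \in _); rewrite ?normr1 ?mul1r//.
by rewrite normr0 mul0r.
Qed.

Let integrable_cut n s : P.-integrable setT (fun w => (cut n (w, s))%:E).
Proof.
apply: le_integrable (iA s) => //.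
  apply/measurable_EFinP; apply: (measurableT_comp (measurable_cut n)).
  exact: pair2_measurable.
by move=> w _; rewrite /= lee_fin cut_le.
Qed.

Let gram_cut n w :
  gram L (cut n) w = (\1_(small n) w.1 * \1_(small n) w.2)%:E * K w.
Proof.
rewrite /K /gram -integralZl//; last exact: integrable_featureM.
by apply: eq_integral => s _; rewrite -EFinM /cut /= mulrACA.
Qed.

Let gram_cut_fubini n :
  (psquare P).-integrable setT (gram L (cut n)) /\
  \int[psquare P]_w gram L (cut n) w =
    \int[L]_s (mean_feature P (cut n) s ^+ 2)%:E.
Proof.
apply: gram_fubini => //.
apply: (@gram_integrand_bounded _ _ _ _ _ _ _ _ n%:R) => // w.
rewrite (_ : \int[L]_s _ = gram L (cut n) (w, w)); last first.
  by apply: eq_integral => s _; rewrite /= expr2.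
rewrite gram_cut /= indicE; have [|_] := boolP (w \in small n); last first.
  by rewrite mulr0 mul0e lee_fin.
by rewrite inE mulr1 mul1e.
Qed.

Let near_small w : \forall n \near \oo, small n w.
Proof.
have := gram_fin_num (w, w); rewrite -/K => /fineK Kw.
exists (Num.bound (fine (K (w, w)))) => // n /= kn.
rewrite /small /= -Kw lee_fin; apply/ltW.
have h : (0 <= fine (K (w, w)))%R by rewrite fine_ge0// gram_diag_ge0.
by apply: lt_le_trans (archi_boundP h) _; rewrite ler_nat.
Qed.

Let cut_cvg p : cut n p @[n --> \oo] --> A p.
Proof.
apply: cvg_near_cst; have := near_small p.1; apply: filterS => n pn.
by rewrite /cut indicE mem_set// mul1r.
Qed.

Let gram_cut_near w : \forall n \near \oo, gram L (cut n) w = K w.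
Proof.
have := near_small w.2; have := near_small w.1; apply: filterS2 => n w1 w2.
by rewrite gram_cut !indicE !mem_set//= mulr1 mul1e.
Qed.

Let measurable_gram_cut n : measurable_fun setT (gram L (cut n)).
Proof. exact: measurable_gram. Qed.

Let gram_cut_ind n w : gram L (cut n) w = K w \/ gram L (cut n) w = 0.
Proof.
rewrite gram_cut !indicE; case: (_ \in _); case: (_ \in _) => /=.
- by left; rewrite mulr1 mul1e.
- by right; rewrite mulr0 mul0e.
- by right; rewrite mul0r mul0e.
- by right; rewrite mul0r mul0e.
Qed.

Let mean_cut_cvg s : mean_feature P (cut n) s @[n --> \oo] --> mean_feature P A s.
Proof.
have iabs : P.-integrable setT (fun w => `|(A (w, s))%:E|) by exact: integrable_abse.
apply: fine_cvg; rewrite fineK; last exact: integrable_fin_num (iA s).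
apply: (dominated_cvg _ _ _ _ iabs) => //.
- by move=> n; exact: measurable_int (integrable_cut n s).
- by move=> w _; apply: cvg_EFin; [exact: nearW|exact: cut_cvg].
- by move=> n w _; rewrite lee_fin cut_le.
Qed.

(** For the cut features the mean of the kernel is exactly the squared norm of the
mean, hence nonnegative: the negative part of the cut kernel integrates to at
most the integral of its positive part, and this is at most that of the positive part of the
whole kernel.  Fatou's lemma then bounds the negative part of the whole kernel, so this
kernel is integrable.  Dominated convergence handles the means of the cut
kernels, Fatou's lemma the squared norms of their mean vectors. *)
Lemma gram_lower :
  \int[psquare P]_w (gram L A)^\+ w < +oo ->
  (psquare P).-integrable setT (gram L A) /\
  \int[L]_s (mean_feature P A s ^+ 2)%:E <= \int[psquare P]_w gram L A w.
Proof.
move=> Kpos.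
have mK : measurable_fun setT K by exact: measurable_gram.
have mKp : measurable_fun setT K^\+ by exact: measurable_funepos.
have mKn : measurable_fun setT K^\- by exact: measurable_funeneg.
have cut_pos n : \int[psquare P]_w (gram L (cut n))^\+ w <= \int[psquare P]_w K^\+ w.
  apply: ge0_le_integral => //.
    by apply: measurable_funepos.
  move=> w _; rewrite !funeposE.
  by case: (gram_cut_ind n w) => -> //; rewrite maxxx le_max lexx orbT.
have cut_neg n : \int[psquare P]_w (gram L (cut n))^\- w <= \int[psquare P]_w K^\+ w.
  apply: le_trans (cut_pos n).
  have [icut] := gram_cut_fubini n.
  rewrite integralE => E.
  have : 0 <= \int[psquare P]_w (gram L (cut n))^\+ w -
              \int[psquare P]_w (gram L (cut n))^\- w.
    by rewrite E; apply: integral_ge0 => s _; rewrite lee_fin sqr_ge0.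
  rewrite sube_ge0//.
  by rewrite integrable_neg_fin_num ?orbT.
have Kneg : \int[psquare P]_w K^\- w < +oo.
  apply: le_lt_trans Kpos.
  apply: (@fatou_le _ _ _ _ (fun n => (gram L (cut n))^\-)) => //.
  - by move=> n; exact: measurable_funeneg.
  - move=> w; apply: cvg_near_cst; have := gram_cut_near w.
    by apply: filterS => n; rewrite !funenegE => ->.
have iK : (psquare P).-integrable setT K.
  apply/integrableP; split => //.
  under eq_integral => w _ do rewrite -/((abse \o K) w) fune_abse.
  by rewrite ge0_integralD// lte_add_pinfty.
split => //.
apply: (@fatou_cvg _ _ _ _ (fun n s => (mean_feature P (cut n) s ^+ 2)%:E)) => //.
- move=> n; apply/measurable_EFinP/measurable_funX.
  by apply: measurable_mean_feature.
- by move=> n s; rewrite lee_fin sqr_ge0.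
- move=> s; apply: cvg_EFin; first exact: nearW.
  by rewrite expr2; apply: cvgM; exact: mean_cut_cvg.
- under eq_fun => n do rewrite -(gram_cut_fubini n).2.
  apply: (dominated_cvg _ _ _ _ (integrable_abse iK)) => //.
  + by move=> w _; exact: cvg_near_cst.
  + by move=> w _; rewrite /= abse_fin_num gram_fin_num.
  + by move=> n w _; case: (gram_cut_ind n w) => -> //; rewrite abse0 abse_ge0.
Qed.

Lemma gram_eq :
  \int[L]_s ((\int[P]_w `|A (w, s)|%:E) ^+ 2) < +oo ->
  \int[psquare P]_w gram L A w = \int[L]_s (mean_feature P A s ^+ 2)%:E.
Proof.
by move=> fin; apply: (gram_fubini _ _ _).2 => //; exact: gram_integrand_mean.
Qed.

(** Either the squared norm of the mean is finite, and then the bound on the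
absolute moments makes Fubini's theorem applicable, or it is infinite, and then
[gram_lower] forbids a finite mean of the kernel. *)
Lemma gram_eq_ge0 (C : R) : (forall w, 0 <= gram L A w) ->
  (forall s, \int[P]_w `|A (w, s)|%:E <= (C * `|mean_feature P A s|)%:E) ->
  \int[psquare P]_w gram L A w = \int[L]_s (mean_feature P A s ^+ 2)%:E.
Proof.
move=> K0 AC.
have mabs : measurable_fun setT (fun p : T * S => `|A p|%:E).
  by apply/measurable_EFinP; exact: measurableT_comp.
have mm : measurable_fun setT (fun s => (mean_feature P A s ^+ 2)%:E).
  by apply/measurable_EFinP/measurable_funX/measurable_mean_feature.
have [fin|] := ltP (\int[L]_s (mean_feature P A s ^+ 2)%:E) +oo.
  apply: gram_eq.
  apply: (@le_lt_trans _ _ (\int[L]_s ((C ^+ 2)%:E * (mean_feature P A s ^+ 2)%:E))).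
    apply: ge0_le_integral => //.
    - by move=> s _; rewrite expe2 mule_ge0// integral_ge0.
    - apply: emeasurable_funM;
      exact: (@measurable_fun_fubini_tonelli_G _ _ _ _ _ P (fun p => `|A p|%:E)).
    - exact: emeasurable_funM.
    - move=> s _; rewrite expe2 -EFinM -(real_normK (num_real (mean_feature _ _ _))).
      rewrite -exprMn expr2 EFinM.
      by apply: lee_pmul => //; exact: integral_ge0.
  rewrite ge0_integralZl ?lee_fin ?sqr_ge0//.
  - apply: lte_mul_pinfty; rewrite ?lee_fin ?sqr_ge0//.
  - by move=> s _; rewrite lee_fin sqr_ge0.
rewrite leye_eq => /eqP mtop.
have [Ky|] := ltP (\int[psquare P]_w gram L A w) +oo.
  have [] := gram_lower.
    rewrite (le_lt_trans _ Ky)// le_eqVlt; apply/orP; left; apply/eqP.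
    by apply: eq_integral => w _; rewrite funeposE max_l.
  by move=> _; rewrite mtop leye_eq => /eqP Ky'; rewrite Ky' ltxx in Ky.
by rewrite mtop leye_eq => /eqP.
Qed.

End gram_kernel.

(** * Centred steps and the kernel of a law *)

(** The reals as integration variable, with the measurable structure that carries
the Lebesgue measure. *)
Definition line (R : realType) : measurableType _ := measurableTypeR R.

Definition leb (R : realType) : {sigma_finite_measure set (line R) -> \bar R} :=
  @lebesgue_measure R.

Definition step (R : realType) (s x : R) : R := (x <= s)%R%:R.

Lemma integral_probability_cst d (T : measurableType d) (R : realType)
  (P : probability T R) (r : R) : \int[P]_x r%:E = r%:E.
Proof. by rewrite -[RHS](expectation_cst P) unlock. Qed.

Lemma integrable_probability_cst d (T : measurableType d) (R : realType)
  (P : probability T R) (r : R) : P.-integrable setT (EFin \o cst r).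
Proof. exact: finite_measure_integrable_cst. Qed.

Section step.
Context (R : realType).
Implicit Types (x z s : R) (mu : probability R R).

Lemma step01 s x : (0 <= step s x <= 1)%R.
Proof. by rewrite /step ler0n lern1 leq_b1. Qed.

Lemma measurable_step : measurable_fun setT (fun p : R * line R => step p.2 p.1).
Proof.
apply: (@measurableT_comp _ _ _ _ _ _ (fun b : bool => (b%:R : R)) _
  (fun p : R * line R => (p.1 <= p.2)%R)) => //.
by apply: measurable_fun_ler; [exact: measurable_fst|exact: measurable_snd].
Qed.

Lemma stepE s : step s = \1_(`]-oo, s]%classic) :> (R -> R).
Proof. by apply/funext => x; rewrite /step indicE mem_setE in_itv. Qed.

Lemma sqr_step_sub x z s : (x <= z)%R ->
  ((step s x - step s z) ^+ 2)%R = \1_(`[x, z[%classic) s.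
Proof.
move=> xz; rewrite /step indicE mem_setE in_itv /=.
have [zs|sz] := leP z s; first by rewrite (le_trans xz zs)/= subrr expr0n.
by rewrite subr0 andbT; case: (_ <= _)%R; rewrite ?expr1n ?expr0n.
Qed.

Lemma integral_sqr_step_sub x z :
  \int[leb R]_s ((step s x - step s z) ^+ 2)%:E = `|x - z|%:E.
Proof.
wlog xz : x z / (x <= z)%R => [wlg|].
  have [/wlg//|/ltW/wlg] := leP x z; rewrite distrC => <-.
  by apply: eq_integral => s _; rewrite -sqrrN opprB.
under eq_integral => s _ do rewrite sqr_step_sub//.
rewrite integral_indic// setIT.
have [xz'|] := ltP x z; last first.
  by move=> zx; have -> : x = z by [apply/eqP; rewrite eq_le xz zx];
     rewrite set_itvco0 ?measure0 ?subrr ?normr0.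
rewrite /leb/= lebesgue_measure_itv/= lte_fin xz' distrC ger0_norm ?subr_ge0//.
Qed.

Lemma integrable_step mu s : mu.-integrable setT (EFin \o step s).
Proof.
rewrite stepE; apply: integrable_indic => //.
Qed.

Definition cdfr mu s : R := fine (mu `]-oo, s]%classic).

Lemma integral_step mu s : \int[mu]_z (step s z)%:E = (cdfr mu s)%:E.
Proof.
rewrite stepE integral_indic// setIT /cdfr fineK//; exact: fin_num_measure.
Qed.

Lemma cdfr_itv mu s : (0 <= cdfr mu s <= 1)%R.
Proof.
rewrite /cdfr fine_ge0// -lee_fin fineK ?probability_le1//.
exact: fin_num_measure.
Qed.

Lemma half_line_mono s s' : (s <= s')%R ->
  (`]-oo, s] `<=` `]-oo, s'])%classic.
Proof. by move=> ss' x /=; rewrite !in_itv /= => /le_trans; apply. Qed.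

Lemma cdfr_mono mu s s' : (s <= s')%R -> (cdfr mu s <= cdfr mu s')%R.
Proof.
move=> ss'; rewrite /cdfr fine_le ?fin_num_measure//.
by apply: le_measure; rewrite ?inE//; exact: half_line_mono.
Qed.

Definition centered mu (p : R * line R) : R := (step p.2 p.1 - cdfr mu p.2)%R.

Lemma centered_le1 mu p : (`|centered mu p| <= 1)%R.
Proof.
have := step01 p.2 p.1; have := cdfr_itv mu p.2; rewrite /centered ler_norml.
by move=> /andP[? ?] /andP[? ?]; apply/andP; split; lra.
Qed.

(** The feature whose mean over [z] is the centred step at [x], and whose Gram
kernel is the distance expression of the kernel on the diagonal. *)
Let dev x (p : R * line R) : R := (step p.2 x - step p.2 p.1)%R.

Let measurable_dev x : measurable_fun setT (dev x).
Proof.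
apply: measurable_funB; last exact: measurable_step.
apply: (measurableT_comp measurable_step
  (_ : measurable_fun setT (fun p : R * line R => (x, p.2)))).
exact: measurable_fun_pair.
Qed.

Let integrable_dev mu x s : mu.-integrable setT (fun z => (dev x (z, s))%:E).
Proof.
have := integrableB measurableT (integrable_probability_cst mu (step s x)) (integrable_step mu s).
by [].
Qed.

Let mean_dev mu x s : mean_feature mu (dev x) s = centered mu (x, s).
Proof.
rewrite /mean_feature /dev /= RintegralB//=.
- by rewrite /Rintegral integral_step integral_probability_cst.
- exact: integrable_probability_cst.
- exact: integrable_step.
Qed.

(** The distribution function is measurable in [s] because it is, up to a step, the
mean of the jointly measurable [dev 0]. *)
Lemma measurable_centered mu : measurable_fun setT (centered mu).
Proof.
apply: measurable_funB; first exact: measurable_step.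
apply: (@measurableT_comp _ _ _ _ _ _ (cdfr mu : line R -> R)) => //.
have := measurable_mean_feature (measurable_dev 0) (integrable_dev mu 0).
have -> : mean_feature mu (dev 0) = (fun s => step s 0 - cdfr mu s)%R.
  by apply/funext => s; rewrite mean_dev.
move=> m.
have -> : cdfr mu = (fun s : line R => step s 0 - (step s 0 - cdfr mu s))%R.
  by apply/funext => s; rewrite subKr.
apply: measurable_funB => //.
by have := measurable_section2 (0%R : R) measurable_step.
Qed.

Let integrable_dev2 x z : (leb R).-integrable setT (fun s => (dev x (z, s) ^+ 2)%:E).
Proof.
apply/integrableP; split.
  by apply/measurable_EFinP/measurable_funX; exact: measurable_section2.
under eq_integral => s _ do rewrite gee0_abs ?lee_fin ?sqr_ge0//.
by rewrite integral_sqr_step_sub ltry.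
Qed.

(** At a given [s] the step difference has the same sign for all [z], so that the
absolute moment is the absolute value of the mean. *)
Let integral_abs_dev mu x s :
  \int[mu]_z `|dev x (z, s)|%:E <= (1 * `|mean_feature mu (dev x) s|)%:E.
Proof.
rewrite mul1r mean_dev /dev /centered /= {1 3}/step.
have [xs|sx] := leP x s.
  under eq_integral => z _.
    rewrite ger0_norm; last by rewrite subr_ge0; case/andP: (step01 s z).
    over.
  rewrite integralB_EFin//; last 2 first.
  - exact: integrable_probability_cst.
  - exact: integrable_step.
  rewrite integral_probability_cst integral_step ger0_norm ?EFinB//.
  by rewrite subr_ge0; case/andP: (cdfr_itv mu s).
under eq_integral => z _.
  rewrite sub0r normrN ger0_norm; last by case/andP: (step01 s z).
  over.
rewrite integral_step sub0r normrN ger0_norm//.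
by case/andP: (cdfr_itv mu s).
Qed.

Let gram_dev x (w : R * R) : gram (leb R) (dev x) w =
  (2^-1 * (`|x - w.1| + `|x - w.2| - `|w.1 - w.2|))%:E.
Proof.
have E s : (dev x (w.1, s) * dev x (w.2, s))%:E = (2^-1)%:E *
   ((dev x (w.1, s) ^+ 2 + dev x (w.2, s) ^+ 2)%:E - ((step s w.1 - step s w.2) ^+ 2)%:E).
  by rewrite -EFinB -EFinM; congr EFin; rewrite /dev /=; field.
rewrite /gram; under eq_integral => s _ do rewrite E.
have i12 := integrable_dev2 w.1 w.2.
have isum : (leb R).-integrable setT
    (fun s => (dev x (w.1, s) ^+ 2 + dev x (w.2, s) ^+ 2)%:E).
  by have := integrableD measurableT (integrable_dev2 x w.1) (integrable_dev2 x w.2).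
rewrite integralZl//; last exact: integrableB.
rewrite integralB_EFin// integralD_EFin ?integral_sqr_step_sub//; exact: integrable_dev2.
Qed.

(** The triangle inequality. *)
Let gram_dev_ge0 x w : 0 <= gram (leb R) (dev x) w.
Proof.
rewrite gram_dev lee_fin mulr_ge0 ?invr_ge0// subr_ge0.
by rewrite (distrC x); exact: ler_distD.
Qed.

(** By the triangle inequality the Gram kernel of [dev x] is nonnegative, so that
[gram_eq_ge0] applies and gives an equality in [0, +oo]. *)
Lemma hker_diag mu x :
  hker mu x x = \int[leb R]_s (centered mu (x, s) ^+ 2)%:E.
Proof.
transitivity (\int[psquare mu]_w gram (leb R) (dev x) w).
  rewrite /hker unlock.
  have E (w : R * R) : (`|x - x| - `|x - w.2| - `|w.1 - x| + `|w.1 - w.2|)%:E =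
      - (2%:E * gram (leb R) (dev x) w).
    by rewrite gram_dev -EFinM -EFinN subrr normr0 (distrC w.1 x); congr EFin; field.
  under eq_integral => w _ do rewrite E.
  rewrite integral_ge0N; last by move=> w _; rewrite mule_ge0.
  rewrite ge0_integralZl//; last exact: measurable_gram.
  by rewrite muleN EFinN mulNe oppeK muleA -EFinM mulVf// mul1e.
rewrite (gram_eq_ge0 (measurable_dev x) (integrable_dev mu x) _ _ (integral_abs_dev mu x))//.
by under eq_integral => s _ do rewrite mean_dev.
Qed.

End step.

Definition four_dist (R : realType) (x y : R) (z : R * R) : R :=
  (`|x - y| - `|x - z.2| - `|z.1 - y| + `|z.1 - z.2|)%R.

Lemma measurable_four_dist (R : realType) (x y : R) :
  measurable_fun setT (four_dist x y).
Proof.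
apply: measurable_funD; last first.
  by apply: measurableT_comp => //; apply: measurable_funB.
apply: measurable_funB; last first.
  by apply: measurableT_comp => //; apply: measurable_funB.
apply: measurable_funB => //.
by apply: measurableT_comp => //; apply: measurable_funB.
Qed.

Lemma hker_four_dist (R : realType) (mu : probability R R) (x y : R) :
  hker mu x y = (- 2^-1)%:E * \int[psquare mu]_z (four_dist x y z)%:E.
Proof. by rewrite /hker unlock. Qed.

Section kernel.
Context (R : realType) (mu : probability R R).
Implicit Types x z s : R.

Hypothesis mu_ex : hker_exists mu.

(** Moving [(x1, x2)] changes the integrand by a bounded amount, so integrability at
one pair of points gives integrability at all pairs. *)
Let integrable_four_dist x1 x2 : (psquare mu).-integrable setT (EFin \o four_dist x1 x2).
Proof.
have [[y1 y2]] := mu_ex; rewrite hker_four_dist /= => fin.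
have iG : (psquare mu).-integrable setT (EFin \o four_dist y1 y2).
  have fin' : \int[psquare mu]_w (four_dist y1 y2 w)%:E \is a fin_num.
    move: fin; case: (\int[psquare mu]_w _) => [r//| |].
    - by rewrite lt0_muley ?lte_fin ?oppr_lt0 ?invr_gt0.
    - by rewrite lt0_muleNy ?lte_fin ?oppr_lt0 ?invr_gt0.
  have mE : measurable_fun setT (EFin \o four_dist y1 y2) by apply/measurable_EFinP; exact: measurable_four_dist.
  apply/integrableP; split => //.
  under eq_integral => w _ do rewrite -/((abse \o (EFin \o four_dist y1 y2)) w) fune_abse.
  rewrite ge0_integralD//; last 2 first.
  - exact: measurable_funepos.
  - exact: measurable_funeneg.
  rewrite integralE fin_numB in fin'; have /andP[a b] := fin'.
  by apply: lte_add_pinfty; rewrite -ge0_fin_numE//; exact: integral_ge0.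
pose c : R := (2 * (`|x1 - y1| + `|x2 - y2|))%R.
have := integrableD measurableT (integrable_abse iG) (integrable_probability_cst (psquare mu) c).
apply: le_integrable => //.
  by apply/measurable_EFinP; exact: measurable_four_dist.
move=> w _; rewrite /= lee_fin [leRHS]ger0_norm; last first.
  by rewrite addr_ge0// mulr_ge0// addr_ge0.
rewrite -lerBlDl; apply: le_trans (lerB_dist _ _) _.
rewrite /four_dist /c.
have h1 := ler_dist_dist (x1 - x2)%R (y1 - y2)%R.
have h2 := ler_dist_dist (x1 - w.2)%R (y1 - w.2)%R.
have h3 := ler_dist_dist (w.1 - x2)%R (w.1 - y2)%R.
have e1 : (x1 - w.2 - (y1 - w.2) = x1 - y1)%R by ring.
have e2 : (w.1 - x2 - (w.1 - y2) = - (x2 - y2))%R by ring.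
have e3 : (x1 - x2 - (y1 - y2) = (x1 - y1) - (x2 - y2))%R by ring.
rewrite e1 in h2; rewrite e2 normrN in h3; rewrite e3 in h1.
have h4 := ler_normB (x1 - y1)%R (x2 - y2)%R.
move: h1 h2 h3; rewrite !ler_norml => /andP[? ?] /andP[? ?] /andP[? ?].
by apply/andP; split; lra.
Qed.

(** The squared L2 norm of the centred step at [x], see [hnormE]. *)
Definition hnorm x : R := fine (hker mu x x).

Let hker_Rintegral x1 x2 :
  hker mu x1 x2 = (- 2^-1 * Rintegral (psquare mu) setT (four_dist x1 x2))%:E.
Proof.
rewrite hker_four_dist EFinM /Rintegral fineK//.
exact: integrable_fin_num (integrable_four_dist x1 x2).
Qed.

Let dif x1 x2 (z : R) : R := (`|x1 - z| - `|x2 - z|)%R.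

Let integrable_dif x1 x2 : mu.-integrable setT (EFin \o dif x1 x2).
Proof.
have := integrable_probability_cst mu `|x1 - x2|%R.
apply: le_integrable => //.
  apply/measurable_EFinP/measurable_funB.
  - by apply: measurableT_comp => //; apply: measurable_funB.
  - by apply: measurableT_comp => //; apply: measurable_funB.
move=> z _; rewrite /= lee_fin normr_id.
have -> : (x1 - x2 = (x1 - z) - (x2 - z))%R by ring.
exact: ler_dist_dist.
Qed.

(** Polarization.  The three four-distance expressions at [(x1, x2)], [(x1, x1)] and
[(x2, x2)] differ by a function of the first coordinate minus the same function
of the second, which integrates to zero; this function is bounded, while the
distances themselves need not be integrable. *)
Lemma hkerE_hnorm x1 x2 :
  hker mu x1 x2 = (2^-1 * (hnorm x1 + hnorm x2 - `|x1 - x2|))%:E.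
Proof.
have [i1 e1] := integral_prod_mul (integrable_dif x1 x2) (integrable_probability_cst mu 1).
have [i2 e2] := integral_prod_mul (integrable_probability_cst mu 1) (integrable_dif x1 x2).
rewrite /hnorm !hker_Rintegral /=; congr EFin.
have idif : (psquare mu).-integrable setT
   (EFin \o (fun w : R * R => dif x1 x2 w.1 * 1 - 1 * dif x1 x2 w.2)%R).
  by have := integrableB measurableT i1 i2.
have idifc : (psquare mu).-integrable setT
   (EFin \o (fun w : R * R => 2 * `|x1 - x2| + (dif x1 x2 w.1 * 1 - 1 * dif x1 x2 w.2))%R).
  by have := integrableD measurableT
    (integrable_probability_cst (psquare mu) (2 * `|x1 - x2|)%R) idif.
have iGG : (psquare mu).-integrable setT (EFin \o (fun w => four_dist x1 x1 w + four_dist x2 x2 w)%R).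
  by have := integrableD measurableT (integrable_four_dist x1 x1) (integrable_four_dist x2 x2).
have E : four_dist x1 x2 = (fun w => 2^-1 * ((four_dist x1 x1 w + four_dist x2 x2 w) +
    (2 * `|x1 - x2| + (dif x1 x2 w.1 * 1 - 1 * dif x1 x2 w.2))))%R.
  apply/funext => w; rewrite /four_dist /dif !subrr normr0 (distrC w.1 x1) (distrC w.1 x2).
  by field.
have dif0 : Rintegral (psquare mu) setT
    (fun w : R * R => dif x1 x2 w.1 * 1 - 1 * dif x1 x2 w.2)%R = 0%R.
  rewrite RintegralB// /Rintegral /= e1 e2.
  by rewrite integral_probability_cst mule1 mul1e subrr.
rewrite [in LHS]E RintegralZl//; last by have := integrableD measurableT iGG idifc.
rewrite (RintegralD measurableT iGG idifc).
rewrite (RintegralD measurableT (integrable_four_dist x1 x1) (integrable_four_dist x2 x2)).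
rewrite (RintegralD measurableT
  (integrable_probability_cst (psquare mu) (2 * `|x1 - x2|)%R) idif).
rewrite dif0 /Rintegral integral_probability_cst /=.
by field.
Qed.

Lemma hnormE x : \int[leb R]_s (centered mu (x, s) ^+ 2)%:E = (hnorm x)%:E.
Proof. by rewrite /hnorm -hker_diag hker_Rintegral. Qed.

Lemma integrable_centered2 x :
  (leb R).-integrable setT (fun s => (centered mu (x, s) ^+ 2)%:E).
Proof.
apply/integrableP; split.
  apply/measurable_EFinP/measurable_funX; apply: measurable_section2.
  exact: measurable_centered.
under eq_integral => s _ do rewrite gee0_abs ?lee_fin ?sqr_ge0//.
by rewrite hnormE ltry.
Qed.

Lemma hker_gram x1 x2 : hker mu x1 x2 = gram (leb R) (centered mu) (x1, x2).
Proof.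
rewrite hkerE_hnorm.
have E s : (centered mu (x1, s) * centered mu (x2, s))%:E = (2^-1)%:E *
   ((centered mu (x1, s) ^+ 2 + centered mu (x2, s) ^+ 2)%:E -
    ((step s x1 - step s x2) ^+ 2)%:E).
  by rewrite -EFinB -EFinM; congr EFin; rewrite /centered /=; field.
rewrite /gram; under eq_integral => s _ do rewrite E.
have isum : (leb R).-integrable setT
    (EFin \o (fun s => centered mu (x1, s) ^+ 2 + centered mu (x2, s) ^+ 2)%R).
  by have := integrableD measurableT (integrable_centered2 x1) (integrable_centered2 x2).
have istep : (leb R).-integrable setT (EFin \o (fun s => (step s x1 - step s x2) ^+ 2)%R).
  apply/integrableP; split.
    apply/measurable_EFinP/measurable_funX/measurable_funB.
    - by have := measurable_section2 x1 (@measurable_step R).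
    - by have := measurable_section2 x2 (@measurable_step R).
  under eq_integral => s _ do rewrite gee0_abs ?lee_fin ?sqr_ge0//.
  by rewrite integral_sqr_step_sub ltry.
rewrite integralZl//; last exact: integrableB.
rewrite integralB_EFin// integralD_EFin//; [|exact: integrable_centered2..].
by rewrite !hnormE integral_sqr_step_sub.
Qed.

End kernel.

(** * The features of a pair of random variables *)

Section joint_features.
Context d (T : measurableType d) (R : realType) (P : probability T R).
Implicit Types X Y : {RV P >-> R}.

Definition plane : measurableType _ := (line R * line R)%type.

Definition leb2 : {sigma_finite_measure set plane -> \bar R} := msquare (leb R).

Definition feature X (p : T * line R) : R :=
  centered (distribution P X) (X p.1, p.2).

(** Its Gram kernel is the product of the two kernels, because integrals of products
over the plane factor. *)
Definition joint_feature X Y (p : T * plane) : R :=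
  (feature X (p.1, p.2.1) * feature Y (p.1, p.2.2))%R.

Definition joint_cdf X Y (s t : R) : R :=
  fine (P (X @^-1` `]-oo, s]%classic `&` Y @^-1` `]-oo, t]%classic)).

(** Hoeffding's covariance kernel: the covariance of the indicators of [X <= s] and
[Y <= t]. *)
Definition cdf_gap X Y (p : plane) : R :=
  (joint_cdf X Y p.1 p.2 -
   cdfr (distribution P X) p.1 * cdfr (distribution P Y) p.2)%R.

Lemma measurable_RV X : measurable_fun setT X.
Proof. exact: measurable_funP. Qed.

Lemma measurable_feature X : measurable_fun setT (feature X).
Proof.
apply: (measurableT_comp (measurable_centered _)); apply: measurable_fun_pair => //.
apply: (measurableT_comp (measurable_RV X)); exact: measurable_fst.
Qed.

Lemma measurable_joint_feature X Y : measurable_fun setT (joint_feature X Y).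
Proof.
apply: measurable_funM.
- apply: (measurableT_comp (measurable_feature X)); apply: measurable_fun_pair => //.
  exact: (measurableT_comp measurable_fst measurable_snd).
- apply: (measurableT_comp (measurable_feature Y)); apply: measurable_fun_pair => //.
  exact: (measurableT_comp measurable_snd measurable_snd).
Qed.

Lemma integrable_joint_feature X Y s :
  P.-integrable setT (fun w => (joint_feature X Y (w, s))%:E).
Proof.
have := integrable_probability_cst P (1 : R)%R; apply: le_integrable => //.
  apply/measurable_EFinP.
  apply: (measurableT_comp (measurable_joint_feature X Y)).
  exact: pair2_measurable.
move=> w _; rewrite /= lee_fin normr1 normrM.
rewrite -[leRHS]mulr1; apply: ler_pM => //; exact: centered_le1.
Qed.

Lemma joint_feature_gram X Y :
  hker_exists (distribution P X) -> hker_exists (distribution P Y) ->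
  (forall w, leb2.-integrable setT (fun s => (joint_feature X Y (w, s) ^+ 2)%:E)) /\
  gram leb2 (joint_feature X Y) = kappa_integrand P X Y.
Proof.
move=> hX hY; split=> [w|].
  have [i _] := integral_prod_mul (integrable_centered2 hX (X w)) (integrable_centered2 hY (Y w)).
  rewrite (_ : (fun _ => _) = (fun z : plane =>
    (centered (distribution P X) (X w, z.1) ^+ 2 *
     centered (distribution P Y) (Y w, z.2) ^+ 2)%:E))//.
  by apply/funext => z; rewrite /joint_feature exprMn.
apply/funext => w; rewrite /kappa_integrand !hker_gram// /gram.
have iX := integrable_featureM (@measurable_centered R (distribution P X))
  (integrable_centered2 hX) (X w.1) (X w.2).
have iY := integrable_featureM (@measurable_centered R (distribution P Y))
  (integrable_centered2 hY) (Y w.1) (Y w.2).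
have [_ <-] := integral_prod_mul iX iY.
by apply: eq_integral => z _; rewrite /joint_feature /feature mulrACA.
Qed.

Lemma integral_affine_indic (A B : set T) (a b a' b' : R) :
  measurable A -> measurable B ->
  Rintegral P setT (fun w => (a + b * \1_A w) * (a' + b' * \1_B w))%R =
  (a * a' + a * b' * fine (P B) + b * a' * fine (P A) +
   b * b' * fine (P (A `&` B)))%R.
Proof.
move=> mA mB; have mAB : measurable (A `&` B) by exact: measurableI.
have iP (C : set T) (k : R) : measurable C ->
    P.-integrable setT (EFin \o (fun w => k * \1_C w)%R).
  by move=> mC; have := integrableZl measurableT k (integrable_indic P mC).
have vP (C : set T) (k : R) : measurable C ->
    Rintegral P setT (fun w => k * \1_C w)%R = (k * fine (P C))%R.
  move=> mC; rewrite RintegralZl//; last exact: integrable_indic.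
  by rewrite /Rintegral integral_indic// setIT.
have i0 := integrable_probability_cst P (a * a')%R.
have i1 := iP B (a * b')%R mB.
have i2 := iP A (b * a')%R mA.
have i3 := iP (A `&` B) (b * b')%R mAB.
have i01 : P.-integrable setT (EFin \o (fun w => a * a' + a * b' * \1_B w)%R).
  by have := integrableD measurableT i0 i1.
have i012 : P.-integrable setT
    (EFin \o (fun w => a * a' + a * b' * \1_B w + b * a' * \1_A w)%R).
  by have := integrableD measurableT i01 i2.
transitivity (Rintegral P setT (fun w =>
    a * a' + a * b' * \1_B w + b * a' * \1_A w + b * b' * \1_(A `&` B) w)%R).
  by congr Rintegral; apply/funext => w; rewrite indicI /=; ring.
rewrite (RintegralD measurableT i012 i3) (RintegralD measurableT i01 i2).
rewrite (RintegralD measurableT i0 i1) !vP//.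
by rewrite /Rintegral integral_probability_cst.
Qed.

Let half (s : R) : set R := `]-oo, s]%classic.

Let measurable_pre X s : measurable (X @^-1` half s).
Proof.
by rewrite -[X @^-1` _]setTI; apply: measurable_RV => //; exact: measurable_itv.
Qed.

Let stepX X s w : step s (X w) = \1_(X @^-1` half s) w :> R.
Proof. by rewrite stepE. Qed.

Lemma mean_joint_feature X Y : mean_feature P (joint_feature X Y) = cdf_gap X Y.
Proof.
apply/funext => p; rewrite /cdf_gap /mean_feature /joint_feature /feature /centered /=.
under eq_Rintegral => w _.
  rewrite (_ : (_ * _)%R =
    ((- cdfr (distribution P X) p.1 + 1 * \1_(X @^-1` half p.1) w) *
     (- cdfr (distribution P Y) p.2 + 1 * \1_(Y @^-1` half p.2) w))%R).
    over.
  by rewrite !stepX; ring.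
rewrite /= integral_affine_indic//.
rewrite -/(joint_cdf X Y p.1 p.2) -/(cdfr (distribution P X) p.1).
rewrite -/(cdfr (distribution P Y) p.2).
by ring.
Qed.

(** With [F] the value of the distribution function at [s], the absolute value of the
centred step at [x] is [1 - F] or [F] according to whether [x <= s], that is,
[F + (1 - 2 F) 1{x <= s}]. *)
Lemma integral_abs_joint_feature X Y p :
  \int[P]_w `|joint_feature X Y (w, p)|%:E =
  (let F := cdfr (distribution P X) p.1 in let G := cdfr (distribution P Y) p.2 in
   F * G + F * (1 - 2 * G) * G + (1 - 2 * F) * G * F +
   (1 - 2 * F) * (1 - 2 * G) * joint_cdf X Y p.1 p.2)%:E.
Proof.
have absE mu (s x : R) : (`|step s x - cdfr mu s| = cdfr mu s + (1 - 2 * cdfr mu s) * step s x)%R.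
  have /andP[F0 F1] := cdfr_itv mu s; rewrite /step.
  case: (_ <= _)%R => /=; first by rewrite ger0_norm ?subr_ge0//; ring.
  by rewrite sub0r normrN ger0_norm//; ring.
rewrite -[LHS]fineK; last first.
  have := integrable_abse (integrable_joint_feature X Y p).
  by move=> /(integrable_fin_num measurableT).
congr EFin; rewrite -/(Rintegral P setT (fun w => `|joint_feature X Y (w, p)|%R)).
rewrite /joint_feature /feature /centered /=.
under eq_Rintegral => w _.
  rewrite normrM !absE !stepX.
  over.
by rewrite /= integral_affine_indic.
Qed.

End joint_features.

(** * Independence through distribution functions *)

(** Closed half-lines form a pi-system that generates the Borel sets. *)
Lemma half_line_measure_unique (R : realType) (m1 m2 : {measure set R -> \bar R}) :
  m1 setT < +oo -> (forall s : R, m1 `]-oo, s]%classic = m2 `]-oo, s]%classic) ->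
  forall A : set R, measurable A -> m1 A = m2 A.
Proof.
move=> m1oo E A mA.
pose G : set (set R) := [set B | exists x : R, B = `]-oo, x]%classic].
have mG (B : set R) : G B -> measurable B by move=> [x ->]; exact: measurable_itv.
apply: (g_sigma_algebra_measure_unique G mG (fun n => `]-oo, n%:R]%classic)).
- by move=> n; exists n%:R.
- apply/seteqP; split => // x _; exists (Num.bound `|x|) => //=.
  rewrite in_itv /=; apply: le_trans (ler_norm x) _.
  by apply/ltW/archi_boundP.
- move=> B C [x ->] [y ->]; exists (Num.min x y).
  by apply/seteqP; split => z /=; rewrite !in_itv /= le_min => /andP.
- by move=> B [x ->].
- move=> n; apply: le_lt_trans m1oo.
  by apply: le_measure => //; rewrite inE //; exact: measurable_itv.
have : (@RGenOInfty.G R).-sigma.-measurable A by rewrite -RGenOInfty.measurableE.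
apply: smallest_sub; first exact: smallest_sigma_algebra.
move=> B [x ->]; rewrite -setCitvl -setTD.
have [_ + _] := smallest_sigma_algebra setT G.
by apply; apply: sub_sigma_algebra; exists x.
Qed.

Section independence.
Context d (T : measurableType d) (R : realType) (P : probability T R).
Implicit Types X Y : {RV P >-> R}.

Lemma measurable_preimage X (A : set R) : measurable A -> measurable (X @^-1` A).
Proof. by move=> mA; rewrite -[X @^-1` _]setTI; apply: measurable_RV. Qed.

Lemma half_line_indep X (B : set T) : measurable B ->
  (forall s : R, P (X @^-1` `]-oo, s]%classic `&` B) =
     P (X @^-1` `]-oo, s]%classic) * P B) ->
  forall A, measurable A -> P (X @^-1` A `&` B) = P (X @^-1` A) * P B.
Proof.
move=> mB E A mA.
have PB : (0 <= fine (P B))%R by exact: fine_ge0.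
pose m1 : {measure set R -> \bar R} := pushforward (mrestr P mB) X.
pose m2 : {measure set R -> \bar R} := mscale (NngNum PB) (distribution P X).
have := @half_line_measure_unique R (m1 (measurable_RV X)) m2.
rewrite /m1 /m2 /mscale /= /pushforward /mrestr => /(_ _ _ A mA).
rewrite /mscale /= fineK ?fin_num_measure// => ->.
- by rewrite muleC.
- by rewrite preimage_setT setTI (le_lt_trans (probability_le1 P mB)) ?ltry.
- by move=> s; rewrite muleC; exact: E.
Qed.

(** The factorization is extended from half-lines to Borel sets in one variable,
then in the other one. *)
Lemma joint_cdf_indep X Y :
  (forall s t, joint_cdf X Y s t =
     (cdfr (distribution P X) s * cdfr (distribution P Y) t)%R) ->
  independent2 P X Y.
Proof.
move=> E A B mA mB.
have mh (Z : {RV P >-> R}) s : measurable (Z @^-1` `]-oo, s]%classic).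
  by apply: measurable_preimage; exact: measurable_itv.
apply: half_line_indep => //; first exact: measurable_preimage.
move=> s; rewrite setIC muleC; apply: half_line_indep => // t.
rewrite setIC muleC.
have := E s t; rewrite /joint_cdf /cdfr /distribution /pushforward => Est.
rewrite -[LHS]fineK ?fin_num_measure//; last by apply: measurableI.
by rewrite Est EFinM !fineK ?fin_num_measure.
Qed.

Lemma indep_joint_cdf X Y : independent2 P X Y -> forall s t,
  joint_cdf X Y s t =
     (cdfr (distribution P X) s * cdfr (distribution P Y) t)%R.
Proof.
move=> I s t; rewrite /joint_cdf I//; try exact: measurable_itv.
by rewrite fineM// fin_num_measure//; apply: measurable_preimage; exact: measurable_itv.
Qed.

(** The modulus of continuity of a joint distribution function is controlled by
those of its marginals. *)
Lemma joint_cdf_rect (A A' B B' : set T) :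
  measurable A -> measurable A' -> measurable B -> measurable B' ->
  A `<=` A' -> B `<=` B' ->
  (0 <= fine (P (A' `&` B')) - fine (P (A `&` B)) <=
   (fine (P A') - fine (P A)) + (fine (P B') - fine (P B)))%R.
Proof.
move=> mA mA' mB mB' AA' BB'.
have mI : measurable (A `&` B) by exact: measurableI.
have mI' : measurable (A' `&` B') by exact: measurableI.
have mD (C C' : set T) : measurable C -> measurable C' -> measurable (C' `\` C).
  by move=> ? ?; exact: measurableD.
have PD (C C' : set T) : measurable C -> measurable C' -> C `<=` C' ->
    (fine (P C') - fine (P C))%R = fine (P (C' `\` C)).
  move=> mC mC' CC'; have C'oo := le_lt_trans (probability_le1 P mC') (ltry _).
  rewrite (@measureD _ _ _ P _ _ mC' mC C'oo) (setIidr CC') fineB//; exact: fin_num_measure.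
apply/andP; split.
  rewrite subr_ge0 fine_le ?fin_num_measure//.
  by apply: le_measure; rewrite ?inE//; exact: setISS.
rewrite (PD A A')// (PD B B')// lerBlDl -!fineD ?fin_num_measure//; try exact: mD.
  rewrite fine_le ?fin_num_measure//.
    by rewrite fin_numD !fin_num_measure// ?fin_numD ?fin_num_measure//; exact: mD.
apply: (@le_trans _ _ (P ((A `&` B) `|` ((A' `\` A) `|` (B' `\` B))))).
  apply: le_measure; rewrite ?inE//.
  - by apply: measurableU => //; apply: measurableU; exact: mD.
  - move=> w [Aw Bw]; have [Aw'|nA] := pselect (A w); last by right; left.
    by have [Bw'|nB] := pselect (B w); [left|right; right].
apply: le_trans (measureU2 _ _ _) _ => //; first by apply: measurableU; exact: mD.
  by rewrite leeD2l// measureU2//; exact: mD.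
by rewrite fin_numD !fin_num_measure//; exact: mD.
Qed.

Lemma cdfr_right_near X (s e : R) : (0 < e)%R ->
  exists2 del : R, (0 < del)%R & forall s' : R, (s < s' < s + del)%R ->
    (0 <= cdfr (distribution P X) s' - cdfr (distribution P X) s < e)%R.
Proof.
move=> e0.
have : cdf X x @[x --> s^'+] --> (fine (cdf X s))%:E.
  by rewrite fineK; [exact: cdf_right_continuous|exact: fin_num_measure].
move=> /fine_cvg/cvgrPdist_lt/(_ e e0).
rewrite /at_right /within /=.
case=> del /= del0 H; exists del => // s' /andP[ss' sd].
have := H s'; rewrite /ball_ /= ss' => /(_ _ isT).
rewrite ltr0_norm; last by rewrite subr_lt0.
rewrite opprB ltrBlDl => /(_ sd).
rewrite -[fine (cdf X s)]/(cdfr (distribution P X) s).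
rewrite -[fine (cdf X s')]/(cdfr (distribution P X) s').
have ge0 : (0 <= cdfr (distribution P X) s' - cdfr (distribution P X) s)%R.
  by rewrite subr_ge0 cdfr_mono// ltW.
by rewrite ge0 /= distrC ger0_norm.
Qed.

(** A nonzero gap at [(s, t)] persists, by right continuity, on a small open square
with lower left corner [(s, t)], which has positive area. *)
Lemma cdf_gap_ae0 X Y :
  {ae leb2 R, forall p, cdf_gap X Y p = 0%R} -> forall s t : R, cdf_gap X Y (s, t) = 0%R.
Proof.
move=> [N [mN N0 sub]] s t; apply: contrapT => /eqP c0.
set F := cdfr (distribution P X); set G := cdfr (distribution P Y).
pose c : R := (joint_cdf X Y s t - F s * G t)%R.
rewrite -[cdf_gap X Y (s, t)]/c in c0.
(* On the square the joint distribution function increases by less than [2 e], and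
so does the product of the marginal ones: the gap moves by less than [`|c|]. *)
pose e : R := (`|c| / 4)%R.
have e0 : (0 < e)%R by rewrite divr_gt0// normr_gt0.
have [d1 d10 H1] := cdfr_right_near X s e0.
have [d2 d20 H2] := cdfr_right_near Y t e0.
pose B : set (plane R) := `]s, (s + d1)%R[%classic `*` `]t, (t + d2)%R[%classic.
have BN : B `<=` N.
  move=> [s' t'] [] /=; rewrite !in_itv /= => hs ht; apply: sub => /= c'0.
  have /andP[ss' _] := hs; have /andP[tt' _] := ht.
  have /andP[l1 l2] : (0 <= joint_cdf X Y s' t' - joint_cdf X Y s t <=
      (F s' - F s) + (G t' - G t))%R.
    apply: joint_cdf_rect; try by apply: measurable_preimage; exact: measurable_itv.
    - exact: preimage_subset (half_line_mono (ltW ss')).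
    - exact: preimage_subset (half_line_mono (ltW tt')).
  have /andP[b1 b2] := H1 _ hs; have /andP[a1 a2] := H2 _ ht.
  rewrite -/(F s) -/(F s') in b1 b2; rewrite -/(G t) -/(G t') in a1 a2.
  move: c'0; rewrite /cdf_gap /= -/(F s') -/(G t') => c'0.
  have /andP[F0 F1] := cdfr_itv (distribution P X) s.
  have /andP[G0 G1] := cdfr_itv (distribution P Y) t'.
  rewrite -/(F s) in F0 F1; rewrite -/(G t') in G0 G1.
  have p1 := mulr_ge0 b1 G0.
  have p2 := ler_piMr b1 G1.
  have p3 := mulr_ge0 F0 a1.
  have p4 := ler_piMl a1 F1.
  have cE : c = (joint_cdf X Y s t - F s * G t)%R by [].
  have [cp|cn] := leP 0%R c.
    have E : (c = 4 * e)%R by rewrite /e ger0_norm//; field.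
    by clear N0 mN; lra.
  have E : (c = - (4 * e))%R by rewrite /e ltr0_norm//; field.
  by clear N0 mN; lra.
have : 0 < leb2 R B.
  rewrite /leb2 /= product_measure1E//.
  rewrite /leb /= !lebesgue_measure_itv /= !lte_fin !ltrDl d10 d20.
  by rewrite -!EFinB -EFinM lte_fin mulr_gt0// addrAC subrr add0r.
apply/negP; rewrite -leNgt -N0; apply: le_measure; rewrite ?inE//.
by apply: measurableX; exact: measurable_itv.
Qed.

End independence.

(** * Nonnegativity of kappa and independence *)

Section kappa_mean.
Context d (T : measurableType d) (R : realType) (P : probability T R).
Variables X Y : {RV P >-> R}.
Hypothesis hX : hker_exists (distribution P X).
Hypothesis hY : hker_exists (distribution P Y).

Let gramE := (joint_feature_gram hX hY).2.
Let features2 := (joint_feature_gram hX hY).1.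

Lemma kappa_integrable_ge :
  \int[psquare P]_w (kappa_integrand P X Y)^\+ w < +oo ->
  (psquare P).-integrable setT (kappa_integrand P X Y) /\
  \int[leb2 R]_p (cdf_gap X Y p ^+ 2)%:E <= kappa P X Y.
Proof.
rewrite -mean_joint_feature -gramE; rewrite /kappa -gramE.
apply: gram_lower => //.
- exact: measurable_joint_feature.
- exact: integrable_joint_feature.
Qed.

Lemma kappa_eq :
  \int[leb2 R]_p ((\int[P]_w `|joint_feature X Y (w, p)|%:E) ^+ 2) < +oo ->
  kappa P X Y = \int[leb2 R]_p (cdf_gap X Y p ^+ 2)%:E.
Proof.
rewrite -mean_joint_feature /kappa -gramE => fin.
apply: (gram_eq _ _ fin) => //.
- exact: measurable_joint_feature.
- exact: integrable_joint_feature.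
Qed.

(** An infinite positive part leaves, when the integral is defined, only [+oo] as a
value of kappa. *)
Lemma kappa_defined_ge0 : kappa_defined P X Y -> 0 <= kappa P X Y.
Proof.
rewrite /kappa_defined; set p := \int[_]_w _^\+ _; set n := \int[_]_w _^\- _ => def.
have [/kappa_integrable_ge[_]|] := ltP p +oo.
  by apply: le_trans; apply: integral_ge0 => s _; rewrite lee_fin sqr_ge0.
rewrite leye_eq => /eqP py.
rewrite /kappa integralE -/p -/n py; move: def; rewrite py.
case: n => [r _| |_].
- by rewrite addye// le0y.
- by move=> /negP; rewrite /adde_def.
- by rewrite addye// le0y.
Qed.

Lemma measurable_sqr_cdf_gap :
  measurable_fun setT (fun p => (cdf_gap X Y p ^+ 2)%:E).
Proof.
rewrite -mean_joint_feature; apply/measurable_EFinP/measurable_funX.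
apply: measurable_mean_feature; first exact: measurable_joint_feature.
exact: integrable_joint_feature.
Qed.

(** An infinite positive part is excluded because the integral would then be
infinite: [+oo - +oo] is [-oo]. *)
Lemma kappa0_indep : kappa P X Y = 0 -> independent2 P X Y.
Proof.
move=> k0.
have pos : \int[psquare P]_w (kappa_integrand P X Y)^\+ w < +oo.
  rewrite ltey; apply/eqP => py; move: k0; rewrite /kappa integralE py.
  by case: (\int[_]_x _ x).
have [_] := kappa_integrable_ge pos; rewrite k0 => gap_le0.
apply: joint_cdf_indep => s t; apply/eqP; rewrite -subr_eq0; apply/eqP.
apply: (@cdf_gap_ae0 _ _ _ P X Y) => /=.
have := (ae_eq_integral_abs (leb2 R) measurableT measurable_sqr_cdf_gap).1.
have -> : \int[leb2 R]_p `|(cdf_gap X Y p ^+ 2)%:E| = 0.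
  apply/eqP; rewrite eq_le integral_ge0// andbT.
  apply: le_trans gap_le0; rewrite le_eqVlt; apply/orP; left; apply/eqP.
  by apply: eq_integral => p _; rewrite gee0_abs// lee_fin sqr_ge0.
move=> /(_ erefl); apply: filterS => p /(_ I) /=.
by move=> [] /eqP; rewrite sqrf_eq0 => /eqP.
Qed.

(** Under independence the first absolute moment of the joint feature factors into
the terms [2 F (1 - F)] and [2 G (1 - G)], which are square integrable because
both kernels exist. *)
Lemma indep_kappa0 : independent2 P X Y -> kappa P X Y = 0.
Proof.
move=> /indep_joint_cdf ind.
have gap0 p : cdf_gap X Y p = 0%R by rewrite /cdf_gap ind subrr.
rewrite kappa_eq; last first.
  pose F := cdfr (distribution P X); pose G := cdfr (distribution P Y).
  (* The centred step at the point 0 is [1 - F] or [- F] at each [s], so that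
     [F (1 - F)] is at most its absolute value. *)
  apply: (@le_lt_trans _ _ (\int[leb2 R]_p
      ((4 * centered (distribution P X) (0%R, p.1) ^+ 2) *
       (4 * centered (distribution P Y) (0%R, p.2) ^+ 2))%:E)).
    apply: ge0_le_integral => //.
    - by move=> p _; rewrite expe2 mule_ge0// integral_ge0.
    - apply: emeasurable_funM;
        apply: (@measurable_fun_fubini_tonelli_G _ _ _ _ _ P
          (fun q => `|joint_feature X Y q|%:E)) => //;
        apply/measurable_EFinP; apply: measurableT_comp => //; exact: measurable_joint_feature.
    - apply/measurable_EFinP; apply: measurable_funM; apply: measurable_funM => //;
        apply: measurable_funX.
      + apply: (measurableT_comp (measurable_section2 (0%R : R)
          (measurable_centered (distribution P X)))).
        exact: measurable_fst.
      + apply: (measurableT_comp (measurable_section2 (0%R : R)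
          (measurable_centered (distribution P Y)))).
        exact: measurable_snd.
    - move=> p _; rewrite integral_abs_joint_feature /= ind.
      rewrite -/(F p.1) -/(G p.2) -EFinM lee_fin.
      set lhs := (X in (X <= _)%R).
      have -> : lhs = ((2 * F p.1 * (1 - F p.1)) ^+ 2 * (2 * G p.2 * (1 - G p.2)) ^+ 2)%R.
        by rewrite /lhs; ring.
      have sq mu (s : R) : ((2 * cdfr mu s * (1 - cdfr mu s)) ^+ 2 <=
          4 * centered mu (0%R, s) ^+ 2)%R.
        have /andP[F0 F1] := cdfr_itv mu s; rewrite /centered /=.
        have -> : ((2 * cdfr mu s * (1 - cdfr mu s)) ^+ 2 =
            4 * (cdfr mu s ^+ 2 * (1 - cdfr mu s) ^+ 2))%R by ring.
        rewrite ler_pM2l//; rewrite /step; case: (0 <= s)%R => /=.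
          by rewrite ler_piMl ?sqr_ge0// expr_le1.
        rewrite sub0r sqrrN ler_piMr ?sqr_ge0// expr_le1//; lra.
      by apply: ler_pM; rewrite ?sqr_ge0// sq.
  have iX := integrableZl measurableT 4%R (integrable_centered2 hX 0%R).
  have iY := integrableZl measurableT 4%R (integrable_centered2 hY 0%R).
  have [/(integrable_lty measurableT)] := integral_prod_mul
    (f := fun s => (4 * centered (distribution P X) (0%R, s) ^+ 2)%R)
    (g := fun s => (4 * centered (distribution P Y) (0%R, s) ^+ 2)%R) iX iY.
  by [].
by under eq_integral => p _ do rewrite gap0 expr0n; rewrite integral0.
Qed.

End kappa_mean.

(** * Equality in the Cauchy-Schwarz inequality *)

Section cauchy_schwarz.
Context d (T : measurableType d) (R : realType) (mu : {measure set T -> \bar R}).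
Variables f g : T -> R.
Hypotheses (mf : measurable_fun setT f) (mg : measurable_fun setT g).
Hypotheses (f2 : \int[mu]_w (f w ^+ 2)%:E < +oo).
Hypotheses (g2 : \int[mu]_w (g w ^+ 2)%:E < +oo).

Let integrable_sqr (h : T -> R) : measurable_fun setT h -> \int[mu]_w (h w ^+ 2)%:E < +oo ->
  mu.-integrable setT (EFin \o (fun w => h w ^+ 2)%R).
Proof.
move=> mh h2; apply/integrableP; split.
  exact/measurable_EFinP/measurable_funX.
under eq_integral => w _.
  rewrite gee0_abs; last by rewrite /= lee_fin sqr_ge0.
  over.
by [].
Qed.

Let if2 := integrable_sqr mf f2.
Let ig2 := integrable_sqr mg g2.

Let integrable_mul : mu.-integrable setT (EFin \o (fun w => f w * g w)%R).
Proof.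
have := integrableD measurableT if2 ig2; apply: le_integrable => //.
  exact/measurable_EFinP/measurable_funM.
move=> w _; rewrite lee_fin [leRHS]ger0_norm ?addr_ge0 ?sqr_ge0// normrM.
rewrite -(real_normK (num_real (f w))) -(real_normK (num_real (g w))).
by have := sqr_ge0 (`|f w| - `|g w|)%R; nra.
Qed.

Let ae0_of_sqr (h : T -> R) : measurable_fun setT h ->
  \int[mu]_w (h w ^+ 2)%:E = 0 -> {ae mu, forall w, h w = 0%R}.
Proof.
move=> mh h0.
have mh2 : measurable_fun setT (fun w => (h w ^+ 2)%:E).
  exact/measurable_EFinP/measurable_funX.
have [+ _] := ae_eq_integral_abs mu measurableT mh2.
under eq_integral => w _ do rewrite gee0_abs ?lee_fin ?sqr_ge0//.
move=> /(_ h0); apply: filterS => w /(_ I) /= [] /eqP.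
by rewrite sqrf_eq0 => /eqP.
Qed.

(** With [a] and [b] the norms of [f] and [g], the squared norm of [b f - a g] is
[2 a b (a b - <f, g>)].  If one of the
norms vanishes, so does the function almost everywhere. *)
Lemma cauchy_schwarz_eq :
  \int[mu]_w (f w * g w)%:E <=
    sqrte (\int[mu]_w (f w ^+ 2)%:E * \int[mu]_w (g w ^+ 2)%:E) /\
  (\int[mu]_w (f w * g w)%:E =
    sqrte (\int[mu]_w (f w ^+ 2)%:E * \int[mu]_w (g w ^+ 2)%:E) ->
   exists a b : R, [/\ (0 <= a)%R, (0 <= b)%R, (a != 0%R) || (b != 0%R) &
     {ae mu, forall w, (b * f w = a * g w)%R}]).
Proof.
pose A := fine (\int[mu]_w (f w ^+ 2)%:E).
pose B := fine (\int[mu]_w (g w ^+ 2)%:E).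
pose C := Rintegral mu setT (fun w => f w * g w)%R.
have AE : \int[mu]_w (f w ^+ 2)%:E = A%:E by rewrite fineK//; exact: integrable_fin_num if2.
have BE : \int[mu]_w (g w ^+ 2)%:E = B%:E by rewrite fineK//; exact: integrable_fin_num ig2.
have CE : \int[mu]_w (f w * g w)%:E = C%:E.
  by rewrite /C /Rintegral fineK//; exact: integrable_fin_num integrable_mul.
have A0 : (0 <= A)%R by rewrite -lee_fin -AE integral_ge0// => w _; rewrite lee_fin sqr_ge0.
have B0 : (0 <= B)%R by rewrite -lee_fin -BE integral_ge0// => w _; rewrite lee_fin sqr_ge0.
rewrite AE BE CE -EFinM /=.
pose a := Num.sqrt A; pose b := Num.sqrt B.
have a2 : (a ^+ 2 = A)%R by rewrite sqr_sqrtr.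
have b2 : (b ^+ 2 = B)%R by rewrite sqr_sqrtr.
have a0 : (0 <= a)%R by rewrite sqrtr_ge0.
have b0 : (0 <= b)%R by rewrite sqrtr_ge0.
rewrite sqrtrM// -/a -/b lee_fin.
have [aE|an] := eqVneq a 0%R.
  have f0 : {ae mu, forall w, f w = 0%R}.
    by apply: ae0_of_sqr => //; rewrite AE -a2 aE expr0n.
  have C0 : C = 0%R.
    apply: EFin_inj; rewrite -CE; rewrite (ae_eq_integral (cst 0)) ?integral0//.
      exact/measurable_EFinP/measurable_funM.
    by apply: filterS f0 => w /= -> _; rewrite mul0r.
  rewrite aE mul0r C0; split => // _; exists 0%R, 1%R; split => //.
    by rewrite oner_neq0 orbT.
  by apply: filterS f0 => w ->; rewrite mulr0 mul0r.
have [bE|bn] := eqVneq b 0%R.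
  have g0 : {ae mu, forall w, g w = 0%R}.
    by apply: ae0_of_sqr => //; rewrite BE -b2 bE expr0n.
  have C0 : C = 0%R.
    apply: EFin_inj; rewrite -CE; rewrite (ae_eq_integral (cst 0)) ?integral0//.
      exact/measurable_EFinP/measurable_funM.
    by apply: filterS g0 => w /= -> _; rewrite mulr0.
  rewrite bE mulr0 C0; split => // _; exists 1%R, 0%R; split => //.
    by rewrite oner_neq0.
  by apply: filterS g0 => w ->; rewrite mulr0 mul0r.
have mh : measurable_fun setT (fun w => b * f w - a * g w)%R.
  by apply: measurable_funB; apply: measurable_funM.
have hE : \int[mu]_w ((b * f w - a * g w) ^+ 2)%:E =
    (2 * (a * b) * (a * b - C))%:E.
  transitivity (\int[mu]_w
      ((b ^+ 2 * f w ^+ 2 + a ^+ 2 * g w ^+ 2) - 2 * a * b * (f w * g w))%:E).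
    by apply: eq_integral => w _; congr EFin; ring.
  have i1 := integrableZl measurableT (b ^+ 2)%R if2.
  have i2 := integrableZl measurableT (a ^+ 2)%R ig2.
  have i3 := integrableZl measurableT (2 * a * b)%R integrable_mul.
  have i12 : mu.-integrable setT (EFin \o (fun w => b ^+ 2 * f w ^+ 2 + a ^+ 2 * g w ^+ 2)%R).
    by have := integrableD measurableT i1 i2.
  have Z (k v : R) (h : T -> R) : mu.-integrable setT (EFin \o h) ->
      \int[mu]_w (h w)%:E = v%:E -> \int[mu]_w (k * h w)%:E = (k * v)%:E.
    move=> ih hv; under eq_integral => w _ do rewrite EFinM.
    by rewrite integralZl// hv.
  rewrite integralB_EFin// integralD_EFin//.
  transitivity ((b ^+ 2 * A)%:E + (a ^+ 2 * B)%:E - (2 * a * b * C)%:E).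
    by congr (_ + _ - _); exact: Z.
  transitivity ((b ^+ 2 * A + a ^+ 2 * B - 2 * a * b * C)%:E) => //.
  by congr EFin; rewrite -a2 -b2; ring.
have ab0 : (0 < a * b)%R by rewrite mulr_gt0// lt_def ?an ?bn.
split.
  have : 0 <= \int[mu]_w ((b * f w - a * g w) ^+ 2)%:E.
    by apply: integral_ge0 => w _; rewrite lee_fin sqr_ge0.
  by rewrite hE lee_fin pmulr_rge0 ?subr_ge0// mulr_gt0.
move=> -[CE']; exists a, b; split => //; first by rewrite an.
have := @ae0_of_sqr _ mh; rewrite hE CE' subrr mulr0 => /(_ erefl).
by apply: filterS => w /eqP; rewrite subr_eq0 => /eqP.
Qed.

End cauchy_schwarz.

(** Squaring removes the absolute values.  Subtracting the identities for the
distances to two fixed points [i0] and [i1] with [x i0 <> x i1] cancels the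
quadratic terms and leaves a linear equation for [x i]. *)
Lemma affine_of_similarity (R : realType) (I : Type) (S : set I) (x y : I -> R)
    (a b : R) : b != 0%R ->
  (forall i j, S i -> S j -> b * `|x i - x j| = a * `|y i - y j|)%R ->
  exists p q : R, forall i, S i -> (x i = p * y i + q)%R.
Proof.
move=> b0 E.
have [[i0 Si0]|S0] := pselect (exists i, S i); last first.
  by exists 0%R, 0%R => i Si; exfalso; apply: S0; exists i.
have [[i1 [Si1 n01]]|all0] := pselect (exists i, S i /\ x i <> x i0); last first.
  exists 0%R, (x i0) => i Si; rewrite mul0r add0r; apply: contrapT => n.
  by apply: all0; exists i.
pose r := ((a / b) ^+ 2)%R.
have E2 i j : S i -> S j -> ((x i - x j) ^+ 2 = r * (y i - y j) ^+ 2)%R.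
  move=> Si Sj; rewrite -(real_normK (num_real (x i - x j)%R)).
  rewrite -(real_normK (num_real (y i - y j)%R)) -exprMn; congr (_ ^+ 2)%R.
  by apply: (mulfI b0); rewrite E//; field.
have n : (2 * (x i1 - x i0) != 0)%R.
  by rewrite mulf_neq0// ?pnatr_eq0// subr_eq0; apply/eqP.
exists (r * 2 * (y i1 - y i0) / (2 * (x i1 - x i0)))%R,
  ((r * (y i0 ^+ 2 - y i1 ^+ 2) + x i1 ^+ 2 - x i0 ^+ 2) / (2 * (x i1 - x i0)))%R => i Si.
apply: (mulIf n).
have e0 := E2 _ _ Si Si0; have e1 := E2 _ _ Si Si1.
have : (x i * (2 * (x i1 - x i0)) =
    (x i - x i0) ^+ 2 - (x i - x i1) ^+ 2 + x i1 ^+ 2 - x i0 ^+ 2)%R by ring.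
move=> ->; rewrite e0 e1; field.
by move: n; rewrite mulf_eq0 pnatr_eq0.
Qed.
(** * Points of the support of a joint law *)

Section typical.
Context d (T : measurableType d) (R : realType) (P : probability T R).
Variables X Y : {RV P >-> R}.

Let near_box (x y e : R) : set T :=
  X @^-1` [set z | (`|z - x| < e)%R] `&` Y @^-1` [set z | (`|z - y| < e)%R].

(** The outcomes [w] for which [(X w, Y w)] lies in the support of the law of
[(X, Y)]. *)
Definition typical : set T :=
  [set w | forall e : R, (0 < e)%R -> P (near_box (X w) (Y w) e) != 0].

Let measurable_near_box x y e : measurable (near_box x y e).
Proof.
have mb (c : R) : measurable [set z : R | (`|z - c| < e)%R].
  rewrite (_ : [set _ | _] = ball c e); first exact: measurable_ball.
  by apply/seteqP; split => z /=; rewrite /ball /= distrC.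
by apply: measurableI; exact: measurable_preimage.
Qed.

(** Every outcome outside [typical] lies in one of the countably many null boxes with
rational centre and radius [1 / (k + 1)]. *)
Lemma ae_typical : {ae P, forall w, typical w}.
Proof.
pose box (o : option (rat * rat * nat)) : set T :=
  if o is Some (p, q, k) then
    let B := near_box (ratr p) (ratr q) k.+1%:R^-1 in
    if P B == 0 then B else set0
  else set0.
have boxN o : P.-negligible (box o).
  rewrite /box; case: o => [[[p q] k]|]; last exact: negligible_set0.
  case: ifPn => [/eqP B0|_]; last exact: negligible_set0.
  by exists (near_box (ratr p) (ratr q) k.+1%:R^-1); split => //; exact: measurable_near_box.
pose F (n : nat) : set T := box (unpickle n).
have FN n : P.-negligible (F n) by exact: boxN.
apply: negligibleS (negligible_bigcup FN) => w /=.
move=> /existsNP[e /not_implyP[e0 /negP/negPn/eqP B0]].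
pose k := Num.bound (2 / e)%R.
have kp : (0 < k.+1%:R^-1 :> R)%R by rewrite invr_gt0.
have ke : (k.+1%:R^-1 *+ 2 < e)%R.
  have e2 : (0 <= 2 / e)%R by rewrite divr_ge0// ltW.
  have := archi_boundP e2; rewrite -/k ltr_pdivrMr// => h.
  rewrite -[X in (X < _)%R]mulr_natl ltr_pdivrMr// (lt_le_trans h)//.
  by rewrite mulrC ler_pM2l// ler_nat.
have boxF (o : rat * rat * nat) : box (Some o) w -> (\bigcup_n F n) w.
  by move=> ow; exists (pickle o); [exact: I|rewrite /F pickleK].
have rat_near (x : R) : exists p : rat, (`|x - ratr p| < k.+1%:R^-1)%R.
  have [|p] := @rat_in_itvoo R (x - k.+1%:R^-1)%R (x + k.+1%:R^-1)%R.
    by rewrite ltrD2l gtrN.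
  rewrite in_itv /= => /andP[p1 p2]; by exists p; rewrite distrC ltr_distl p1 p2.
have [p px] := rat_near (X w); have [q qy] := rat_near (Y w).
apply: (boxF (p, q, k)); rewrite /box ifT; first by split => /=.
apply/eqP; apply: (subset_measure0 _ _ _ B0); try exact: measurable_near_box.
move=> v [] /= vp vq.
split => /=.
- have := ler_distD (ratr p) (X v) (X w); rewrite (distrC (ratr p)).
  by move: ke vp px; rewrite mulr2n; set c : R := k.+1%:R^-1%R; lra.
- have := ler_distD (ratr q) (Y v) (Y w); rewrite (distrC (ratr q)).
  by move: ke vq qy; rewrite mulr2n; set c : R := k.+1%:R^-1%R; lra.
Qed.

(** A function of [(X, Y)] and its independent copy that is Lipschitz and vanishes
almost surely vanishes on the square of the support: were it nonzero at a point,
it would be so on a product of two boxes of positive probability. *)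
Lemma typical_eq0 (D : T * T -> R) (C : R) : (0 < C)%R ->
  (forall w v : T * T, (`|D w - D v| <= C * (`|X w.1 - X v.1| + `|X w.2 - X v.2|
      + `|Y w.1 - Y v.1| + `|Y w.2 - Y v.2|))%R) ->
  {ae psquare P, forall w, D w = 0%R} ->
  forall w v, typical w -> typical v -> D (w, v) = 0%R.
Proof.
move=> C0 lip [N [mN N0 sub]] w v tw tv; apply: contrapT => /eqP D0.
(* Each of the four distances is less than [e], so that [D] varies by at most
[4 C e], half of its absolute value at [(w, v)]. *)
pose e : R := (`|D (w, v)| / (8 * C))%R.
have e0 : (0 < e)%R by rewrite divr_gt0 ?normr_gt0// mulr_gt0.
have eE : (`|D (w, v)| = 8 * (C * e))%R by rewrite /e; field; rewrite gt_eqF.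
pose Bw := near_box (X w) (Y w) e; pose Bv := near_box (X v) (Y v) e.
have : psquare P (Bw `*` Bv) != 0.
  rewrite /psquare /= product_measure1E//; try exact: measurable_near_box.
  by rewrite mule_eq0 negb_or tw ?tv.
move=> /eqP; apply; apply: (subset_measure0 _ _ _ N0) => //.
  by apply: measurableX; exact: measurable_near_box.
move=> [w' v'] [] /= [/= xw yw] [/= xv yv]; apply: sub => /= D'0.
have := lip (w', v') (w, v); rewrite /= D'0 sub0r normrN eE.
have : (C * (`|X w' - X w| + `|X v' - X v| + `|Y w' - Y w| + `|Y v' - Y v|) <= C * (4 * e))%R.
  by rewrite ler_pM2l//; lra.
have Ce : (0 < C * e)%R by rewrite mulr_gt0.
by lra.
Qed.

End typical.

(** * Affine changes of variables *)

(** Scaling by [k] multiplies the integrals of both parts by [k], and this commutes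
with their difference even when both are infinite. *)
Lemma integralZl_ge0 d (T : measurableType d) (R : realType)
    (mu : {measure set T -> \bar R}) (f : T -> \bar R) (k : R) :
  measurable_fun setT f -> (0 <= k)%R ->
  \int[mu]_w (k%:E * f w) = k%:E * \int[mu]_w f w.
Proof.
move=> mf; rewrite le_eqVlt => /predU1P[<-|k0].
  by under eq_integral => w _ do rewrite mul0e; rewrite integral0 mul0e.
have mp : measurable_fun setT f^\+ by exact: measurable_funepos.
have mn : measurable_fun setT f^\- by exact: measurable_funeneg.
rewrite integralE ge0_funeposM ?ltW// ge0_funenegM ?ltW//.
rewrite !ge0_integralZl_EFin ?ltW//.
rewrite [in RHS]integralE.
have : 0 <= \int[mu]_w f^\+ w by exact: integral_ge0.
have : 0 <= \int[mu]_w f^\- w by exact: integral_ge0.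
case: (\int[mu]_w f^\+ w) => [p| |]; case: (\int[mu]_w f^\- w) => [n| |] //= _ _.
- by rewrite [RHS](_ : _ = (k * (p - n))%:E)// mulrBr.
- by rewrite gt0_muley ?lte_fin//= gt0_muleNy ?lte_fin.
- by rewrite gt0_muley ?lte_fin.
- by rewrite gt0_muley ?lte_fin//= gt0_muleNy ?lte_fin.
Qed.

Section hker_law.
Context d (T : measurableType d) (R : realType) (P : probability T R).
Implicit Types X Y : {RV P >-> R}.

Let ge0_integral_psquare_distribution X (f : R * R -> \bar R) :
  measurable_fun setT f -> (forall z, 0 <= f z) ->
  \int[psquare (distribution P X)]_z f z = \int[psquare P]_w f (X w.1, X w.2).
Proof.
move=> mf f0.
have mfX : measurable_fun setT (fun w : T * T => f (X w.1, X w.2)).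
  apply: (measurableT_comp mf); apply: measurable_fun_pair.
  - exact: (measurableT_comp (measurable_RV X) measurable_fst).
  - exact: (measurableT_comp (measurable_RV X) measurable_snd).
rewrite /psquare /= fubini_tonelli1// [RHS]fubini_tonelli1// /fubini_F.
rewrite ge0_integral_distribution//; last 2 first.
- exact: (measurable_fun_fubini_tonelli_F (m2 := distribution P X)).
- by move=> x; exact: integral_ge0.
apply: eq_integral => w _ /=; rewrite ge0_integral_distribution//.
exact: (measurableT_comp mf (pair1_measurable _)).
Qed.

Lemma integral_psquare_distribution X (f : R * R -> \bar R) :
  measurable_fun setT f ->
  \int[psquare (distribution P X)]_z f z = \int[psquare P]_w f (X w.1, X w.2).
Proof.
move=> mf; rewrite integralE [RHS]integralE; congr (_ - _).
- rewrite ge0_integral_psquare_distribution//; last exact: measurable_funepos.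
  by apply: eq_integral => w _; rewrite !funeposE.
- rewrite ge0_integral_psquare_distribution//; last exact: measurable_funeneg.
  by apply: eq_integral => w _; rewrite !funenegE.
Qed.

Lemma measurable_four_dist_RV X x y :
  measurable_fun setT (fun w : T * T => (four_dist x y (X w.1, X w.2))%:E).
Proof.
apply/measurable_EFinP; apply: (measurableT_comp (measurable_four_dist x y)
  (_ : measurable_fun setT (fun w : T * T => (X w.1, X w.2)))).
apply: measurable_fun_pair.
- exact: (measurableT_comp (measurable_RV X) measurable_fst).
- exact: (measurableT_comp (measurable_RV X) measurable_snd).
Qed.

Lemma hker_distribution X x y : hker (distribution P X) x y =
  (- 2^-1)%:E * \int[psquare P]_w (four_dist x y (X w.1, X w.2))%:E.
Proof.
rewrite hker_four_dist; congr (_ * _).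
apply: (integral_psquare_distribution X (f := fun z => (four_dist x y z)%:E)).
by apply/measurable_EFinP; exact: measurable_four_dist.
Qed.

Lemma ae_square (A : set T) : {ae P, forall w, A w} ->
  {ae psquare P, forall w, A w.1 /\ A w.2}.
Proof.
move=> [N [mN N0 sub]].
have NT : (psquare P).-negligible (N `*` setT `|` setT `*` N).
  apply: negligibleU.
  - exists (N `*` setT); split => //; first exact: measurableX.
    rewrite /psquare /= product_measure1E//.
    by apply/eqP; rewrite mule_eq0; apply/orP; left; apply/eqP.
  - exists (setT `*` N); split => //; first exact: measurableX.
    rewrite /psquare /= product_measure1E//.
    by apply/eqP; rewrite mule_eq0; apply/orP; right; apply/eqP.
apply: negligibleS NT => -[w1 w2] /= /not_andP[n|n].
- by left; split => //=; exact: sub.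
- by right; split => //=; exact: sub.
Qed.

(** The kernel depends only on the law of the variable, hence an almost sure affine
relation is enough. *)
Lemma hker_ae_affine X Y (a b : R) : {ae P, forall w, Y w = (a * X w + b)%R} ->
  forall x y, hker (distribution P Y) (a * x + b) (a * y + b) =
    `|a|%:E * hker (distribution P X) x y.
Proof.
move=> YX x y; rewrite !hker_distribution.
rewrite muleCA -(integralZl_ge0 _ (measurable_four_dist_RV X x y))//.
congr mule; apply: ae_eq_integral => //.
- exact: measurable_four_dist_RV.
- by apply: emeasurable_funM => //; exact: measurable_four_dist_RV.
apply: filterS (ae_square YX) => w [/= -> ->] _.
rewrite -EFinM; congr EFin; rewrite /four_dist /=.
have E u v : (a * u + b - (a * v + b) = a * (u - v))%R by ring.
by rewrite !E !normrM; ring.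
Qed.

Lemma hker_affine X (a b x y : R) :
  hker (distribution P (affine a b X : {RV P >-> R})) (a * x + b) (a * y + b) =
    `|a|%:E * hker (distribution P X) x y.
Proof. by apply: hker_ae_affine; apply: aeW => w. Qed.

Lemma kappa_integrand_affine X Y (a b c e : R) w :
  kappa_integrand P (affine a b X) (affine c e Y) w =
  (`|a| * `|c|)%:E * kappa_integrand P X Y w.
Proof.
rewrite /kappa_integrand; have := hker_affine X a b (X w.1) (X w.2).
have := hker_affine Y c e (Y w.1) (Y w.2).
by rewrite /affine /= => -> ->; rewrite muleACA -EFinM.
Qed.

Lemma measurable_kappa_integrand X Y :
  hker_exists (distribution P X) -> hker_exists (distribution P Y) ->
  measurable_fun setT (kappa_integrand P X Y).
Proof.
move=> hX hY; rewrite -(joint_feature_gram hX hY).2.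
by apply: measurable_gram; exact: measurable_joint_feature.
Qed.

Lemma kappa_affine X Y (a b c e : R) :
  hker_exists (distribution P X) -> hker_exists (distribution P Y) ->
  kappa P (affine a b X) (affine c e Y) = (`|a| * `|c|)%:E * kappa P X Y.
Proof.
move=> hX hY; rewrite /kappa -integralZl_ge0 ?mulr_ge0//; last first.
  exact: measurable_kappa_integrand.
by apply: eq_integral => w _; exact: kappa_integrand_affine.
Qed.

(** Numerator and denominator are both multiplied by [`|a| * `|c|].  The quotient is
unchanged also when the denominator is 0 or [+oo], whose inverses are [+oo]
and 0. *)
Lemma rho_star_affine X Y (a b c e : R) :
  hker_exists (distribution P X) -> hker_exists (distribution P Y) ->
  a != 0%R -> c != 0%R ->
  rho_star P (affine a b X) (affine c e Y) = rho_star P X Y.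
Proof.
move=> hX hY a0 c0; rewrite /rho_star !kappa_affine//.
pose s := (`|a| * `|c|)%R; have s0 : (0 < s)%R by rewrite mulr_gt0 ?normr_gt0.
rewrite -/s muleACA -EFinM.
have -> : (`|a| * `|a| * (`|c| * `|c|) = s ^+ 2)%R by rewrite /s; ring.
rewrite sqrteM ?lee_fin ?sqr_ge0//= sqrtr_sqr gtr0_norm//.
have := sqrte_ge0 (kappa P X X * kappa P Y Y); case: (sqrte _) => [q| |] // q0.
- have [->|qn] := eqVneq q 0%R.
    rewrite mule0 inve0 muleAC gt0_muley ?lte_fin//.
  rewrite -EFinM !inver mulf_eq0 (negPf qn) gt_eqF//=.
  rewrite muleAC -EFinM; have -> : (s * (s * q)^-1 = q^-1)%R by field; rewrite qn gt_eqF.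
  by rewrite muleC.
- by rewrite gt0_muley ?lte_fin// invey !mule0.
Qed.

End hker_law.

(** * kappa and linear relations *)

(** Where the steps at [x] and [y] differ, the squares of the centred steps are
[(1 - F)^2] and [F^2]; these differ by at most 1 and this happens only between
[x] and [y]. *)
Lemma hnorm_lipschitz (R : realType) (mu : probability R R) (x y : R) :
  hker_exists mu -> (`|hnorm mu x - hnorm mu y| <= 2 * `|x - y|)%R.
Proof.
move=> ex.
have le u v : (hnorm mu u <= hnorm mu v + 2 * `|u - v|)%R.
  rewrite -lee_fin EFinD -!hnormE// EFinM -integral_sqr_step_sub.
  have mc u' : measurable_fun setT (fun s => (centered mu (u', s) ^+ 2)%:E).
    apply/measurable_EFinP/measurable_funX.
    exact: measurable_section2 (measurable_centered mu).
  have ms : measurable_fun setT (fun s : line R => ((step s u - step s v) ^+ 2)%:E).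
    apply/measurable_EFinP/measurable_funX/measurable_funB.
    - by have := measurable_section2 u (@measurable_step R).
    - by have := measurable_section2 v (@measurable_step R).
  rewrite -ge0_integralZl//; last by move=> s _; rewrite lee_fin sqr_ge0.
  rewrite -ge0_integralD//; first last.
  - by apply: emeasurable_funM.
  - by move=> s _; rewrite mule_ge0// lee_fin sqr_ge0.
  - by move=> s _; rewrite lee_fin sqr_ge0.
  apply: ge0_le_integral => //.
  - by move=> s _; rewrite lee_fin sqr_ge0.
  - by apply: emeasurable_funD => //; apply: emeasurable_funM.
  - move=> s _; rewrite -EFinM -EFinD lee_fin /centered /=.
    have /andP[F0 F1] := cdfr_itv mu s.
    by rewrite /step; case: (u <= s)%R; case: (v <= s)%R => /=; nra.
have h1 := le x y; have h2 := le y x; rewrite distrC in h2.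
by rewrite ler_norml; apply/andP; split; lra.
Qed.

Section kappa_equality.
Context d (T : measurableType d) (R : realType) (P : probability T R).
Implicit Types X Y : {RV P >-> R}.

(** The value of the kernel of [X] at two independent copies, in the form of
[hkerE_hnorm], from which it is seen to be Lipschitz. *)
Definition rker X (w : T * T) : R :=
  (2^-1 * (hnorm (distribution P X) (X w.1) + hnorm (distribution P X) (X w.2) -
    `|X w.1 - X w.2|))%R.

Lemma rkerE X w : hker_exists (distribution P X) ->
  hker (distribution P X) (X w.1) (X w.2) = (rker X w)%:E.
Proof. by move=> hX; rewrite hkerE_hnorm. Qed.

Lemma measurable_rker X : hker_exists (distribution P X) ->
  measurable_fun setT (rker X).
Proof.
move=> hX; apply/measurable_EFinP.
rewrite (_ : EFin \o _ = gram (leb R) (feature X)).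
  by apply: measurable_gram; exact: measurable_feature.
by apply/funext => w; rewrite /= -rkerE// hker_gram.
Qed.

Lemma kappa_rker X Y :
  hker_exists (distribution P X) -> hker_exists (distribution P Y) ->
  kappa P X Y = \int[psquare P]_w (rker X w * rker Y w)%:E.
Proof.
move=> hX hY; apply: eq_integral => w _.
by rewrite /kappa_integrand !rkerE.
Qed.

Lemma kappa_sqr X : hker_exists (distribution P X) ->
  kappa P X X = \int[psquare P]_w (rker X w ^+ 2)%:E.
Proof. by move=> hX; rewrite kappa_rker//; apply: eq_integral => w _; rewrite expr2. Qed.

Lemma kappa_ge0 X : hker_exists (distribution P X) -> 0 <= kappa P X X.
Proof.
by move=> hX; rewrite kappa_sqr//; apply: integral_ge0 => w _; rewrite lee_fin sqr_ge0.
Qed.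

Let rker_lip X w v : hker_exists (distribution P X) ->
  (`|rker X w - rker X v| <= 2 * (`|X w.1 - X v.1| + `|X w.2 - X v.2|))%R.
Proof.
move=> hX; rewrite /rker.
have h1 := hnorm_lipschitz (X w.1) (X v.1) hX.
have h2 := hnorm_lipschitz (X w.2) (X v.2) hX.
have h3 := ler_dist_dist (X w.1 - X w.2)%R (X v.1 - X v.2)%R.
have e3 : (X w.1 - X w.2 - (X v.1 - X v.2) = (X w.1 - X v.1) - (X w.2 - X v.2))%R by ring.
rewrite e3 in h3; have h4 := le_trans h3 (ler_normB _ _).
move: h1 h2 h4; rewrite !ler_norml => /andP[? ?] /andP[? ?] /andP[? ?].
by apply/andP; split; lra.
Qed.

(** The proportionality of the kernels holds at all pairs of points of the support.
Taking both points equal gives proportionality of the squared norms; subtracting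
leaves the distances. *)
Let affine_of_rker X Y (a b : R) :
  hker_exists (distribution P X) -> hker_exists (distribution P Y) ->
  (0 <= a)%R -> (0 <= b)%R -> b != 0%R ->
  {ae psquare P, forall w, (b * rker X w = a * rker Y w)%R} ->
  exists p q : R, {ae P, forall w, X w = (p * Y w + q)%R}.
Proof.
move=> hX hY a0 b0 bn ae0.
have D0 w v : typical X Y w -> typical X Y v -> (b * rker X (w, v) = a * rker Y (w, v))%R.
  move=> tw tv; apply/eqP; rewrite -subr_eq0; apply/eqP.
  apply: (@typical_eq0 _ _ _ _ X Y
    (fun w => b * rker X w - a * rker Y w)%R (2 * (a + b))%R) => //.
  - by rewrite mulr_gt0// ltr_wpDl// lt_def bn.
  - move=> u z; have h1 := rker_lip u z hX; have h2 := rker_lip u z hY.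
    have -> : (b * rker X u - a * rker Y u - (b * rker X z - a * rker Y z) =
       b * (rker X u - rker X z) - a * (rker Y u - rker Y z))%R by ring.
    apply: le_trans (ler_normB _ _) _; rewrite !normrM (ger0_norm a0) (ger0_norm b0).
    have h1' := ler_wpM2l b0 h1; have h2' := ler_wpM2l a0 h2.
    have p1 : (0 <= a * (`|X u.1 - X z.1| + `|X u.2 - X z.2|))%R by rewrite mulr_ge0// addr_ge0.
    have p2 : (0 <= b * (`|Y u.1 - Y z.1| + `|Y u.2 - Y z.2|))%R by rewrite mulr_ge0// addr_ge0.
    lra.
  - by apply: filterS ae0 => u ->; rewrite subrr.
have [|p [q E]] := @affine_of_similarity R T (typical X Y) X Y a b bn; last first.
  by exists p, q; apply: filterS (ae_typical X Y) => w /E.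
move=> w v tw tv; have := D0 _ _ tw tv; have := D0 _ _ tw tw; have := D0 _ _ tv tv.
rewrite /rker /= !subrr !normr0; lra.
Qed.

(** The kernel of [a X + b] is [`|a|] times the kernel of [X], so kappa(X, Y) and
kappa(Y, Y) are [`|a|] and [`|a|^2] times kappa(X, X). *)
Lemma kappa_linear X Y (a b : R) :
  hker_exists (distribution P X) -> hker_exists (distribution P Y) ->
  kappa P X X < +oo -> {ae P, forall w, Y w = (a * X w + b)%R} ->
  kappa P X Y = sqrte (kappa P X X * kappa P Y Y).
Proof.
move=> hX hY fin YX.
have kE : {ae psquare P, forall w,
    hker (distribution P Y) (Y w.1) (Y w.2) =
    `|a|%:E * hker (distribution P X) (X w.1) (X w.2)}.
  by apply: filterS (ae_square YX) => w [-> ->]; exact: hker_ae_affine.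
have -> : kappa P X Y = `|a|%:E * kappa P X X.
  rewrite /kappa -integralZl_ge0//; last exact: measurable_kappa_integrand.
  apply: ae_eq_integral => //.
  - exact: measurable_kappa_integrand.
  - by apply: emeasurable_funM => //; exact: measurable_kappa_integrand.
  - by apply: filterS kE => w E _; rewrite /kappa_integrand E muleCA.
have -> : kappa P Y Y = (`|a| ^+ 2)%:E * kappa P X X.
  rewrite /kappa -integralZl_ge0 ?sqr_ge0//; last exact: measurable_kappa_integrand.
  apply: ae_eq_integral => //.
  - exact: measurable_kappa_integrand.
  - by apply: emeasurable_funM => //; exact: measurable_kappa_integrand.
  - by apply: filterS kE => w E _; rewrite /kappa_integrand E muleACA expr2 EFinM.
have := kappa_ge0 hX; move: fin; case: (kappa P X X) => [k| |] // _ k0.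
rewrite -!EFinM /=; congr EFin.
have -> : (k * (`|a| ^+ 2 * k) = (`|a| * k) ^+ 2)%R by ring.
have ak0 : (0 <= `|a| * k)%R by rewrite mulr_ge0// -lee_fin.
by rewrite sqrtr_sqr (ger0_norm ak0).
Qed.

Lemma kappaC X Y : kappa P X Y = kappa P Y X.
Proof. by apply: eq_integral => w _; rewrite /kappa_integrand muleC. Qed.

(** Equality gives nonnegative [a] and [b], not both zero, for which [b] times the
kernel of [X] is [a] times the kernel of [Y].  If [b] is nonzero then [X] is an
affine function of [Y], and otherwise [Y] is one of [X], namely a constant. *)
Lemma kappa_cauchy_schwarz X Y :
  hker_exists (distribution P X) -> hker_exists (distribution P Y) ->
  kappa P X X < +oo -> kappa P Y Y < +oo ->
  kappa P X Y <= sqrte (kappa P X X * kappa P Y Y) /\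
  (kappa P X Y = sqrte (kappa P X X * kappa P Y Y) <-> linearly_related P X Y).
Proof.
move=> hX hY finX finY.
have := finX; have := finY; rewrite !kappa_sqr// => finY' finX'.
have [le eq] := cauchy_schwarz_eq (measurable_rker hX) (measurable_rker hY) finX' finY'.
rewrite -kappa_rker// -!kappa_sqr// in le eq.
rewrite -!kappa_sqr//; split => //; split => [/eq|].
  move=> [a [b [a0 b0 ab E]]].
  have [bz|bn] := eqVneq b 0%R; last first.
    by right; exact: (affine_of_rker hX hY a0 b0 bn E).
  have an : a != 0%R by move: ab; rewrite bz eqxx orbF.
  left; apply: (affine_of_rker hY hX b0 a0 an).
  by apply: filterS E => w ->.
move=> [[a [b YX]]|[a [b XY]]]; first exact: (kappa_linear hX hY finX YX).
by rewrite kappaC muleC; exact: (kappa_linear hY hX finY XY).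
Qed.

End kappa_equality.

(** * Dichotomous variables *)

(** Distances in [{u, v}] are [(x - y)^2 / `|u - v|], and the squares cancel in the
combination of four of them.  The 16 cases are checked one by one. *)
Lemma four_point_dichotomous (R : realType) (u v x y z1 z2 : R) :
  x = u \/ x = v -> y = u \/ y = v -> z1 = u \/ z1 = v -> z2 = u \/ z2 = v ->
  (four_dist x y (z1, z2) * `|u - v| = - (2 * ((x - z1) * (y - z2))))%R.
Proof.
rewrite /four_dist /=.
have dE : (`|u - v| * `|u - v| = (u - v) * (u - v))%R.
  by rewrite -!expr2 real_normK// num_real.
by case=> ->; case=> ->; case=> ->; case=> ->;
  rewrite ?subrr ?normr0 ?(distrC v u); lra.
Qed.

Section dichotomous.
Context d (T : measurableType d) (R : realType) (P : probability T R).
Implicit Types X Y : {RV P >-> R}.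

Let ae_bounded_integrable (f : T -> R) (C : R) : measurable_fun setT f ->
  {ae P, forall w, (`|f w| <= C)%R} -> P.-integrable setT (EFin \o f).
Proof.
move=> mf fC; apply/integrableP; split; first exact/measurable_EFinP.
apply: (@le_lt_trans _ _ (\int[P]_w (`|C|%R)%:E)); last first.
  by rewrite integral_probability_cst ltry.
apply: ae_ge0_le_integral => //.
  by apply: measurableT_comp => //; exact/measurable_EFinP.
by apply: filterS fC => w fw _; rewrite lee_fin (le_trans fw)// ler_norm.
Qed.

Lemma dichotomous_ae X (u v : R) : dichotomous_at P X u v ->
  {ae P, forall w, X w = u \/ X w = v}.
Proof.
move=> [_ P1].
have muv : measurable (X @^-1` [set u; v]).
  by apply: measurable_preimage; apply: measurableU; exact: measurable_set1.
exists (~` (X @^-1` [set u; v])); split => //; first exact: measurableC.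
by rewrite probability_setC// P1 subee.
Qed.

Definition centered_RV X (w : T) : R := (X w - fine 'E_P[X])%R.

Section one_variable.
Variables (X : {RV P >-> R}) (u v : R).
Hypothesis Xuv : dichotomous_at P X u v.

Let Xae := dichotomous_ae Xuv.

Let integrable_X : P.-integrable setT (EFin \o X).
Proof.
apply: (@ae_bounded_integrable _ (`|u| + `|v|)%R).
  exact: measurable_RV.
by apply: filterS Xae => w [] ->; rewrite ?lerDl ?lerDr.
Qed.

Let EX : \int[P]_w (X w)%:E = (fine 'E_P[X])%:E.
Proof. by rewrite unlock fineK//; exact: integrable_fin_num integrable_X. Qed.

Lemma centered_RV_bounded : exists C : R, {ae P, forall w, (`|centered_RV X w| <= C)%R}.
Proof.
exists (`|u| + `|v| + `|fine 'E_P[X]|)%R.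
apply: filterS Xae => w Xw; rewrite /centered_RV.
apply: le_trans (ler_normB _ _) _; rewrite lerD2r.
by case: Xw => ->; rewrite ?lerDl ?lerDr.
Qed.

Let mean_sub x : P.-integrable setT (EFin \o (fun w => x - X w)%R) /\
  \int[P]_w (x - X w)%:E = (x - fine 'E_P[X])%:E.
Proof.
split.
  by have := integrableB measurableT (integrable_probability_cst P x) integrable_X.
rewrite integralB_EFin//; last exact: integrable_probability_cst.
by rewrite integral_probability_cst EX.
Qed.

Lemma hker_dichotomous x y : x = u \/ x = v -> y = u \/ y = v ->
  hker (distribution P X) x y =
  ((x - fine 'E_P[X]) * (y - fine 'E_P[X]) / `|u - v|)%:E.
Proof.
move=> xuv yuv; have [uv _] := Xuv.
have d0 : `|u - v|%R != 0%R by rewrite normr_eq0 subr_eq0.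
rewrite hker_distribution.
pose k : R := (- (2 / `|u - v|))%R.
rewrite (ae_eq_integral (fun w : T * T => k%:E * ((x - X w.1) * (y - X w.2))%:E))//; first last.
- apply: filterS (ae_square Xae) => w [w1 w2] _; rewrite -EFinM; congr EFin.
  have := four_point_dichotomous xuv yuv w1 w2.
  by move=> /(congr1 (fun z => z / `|u - v|)%R); rewrite mulfK// => ->; rewrite /k; field.
- apply: emeasurable_funM => //; apply/measurable_EFinP; apply: measurable_funM;
    apply: measurable_funB => //.
  + exact: (measurableT_comp (measurable_RV X) measurable_fst).
  + exact: (measurableT_comp (measurable_RV X) measurable_snd).
- exact: measurable_four_dist_RV.
have [i1 e1] := mean_sub x; have [i2 e2] := mean_sub y.
have [i12 e12] := integral_prod_mul i1 i2.
rewrite integralZl// /psquare /= e12 e1 e2 -!EFinM; congr EFin.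
by rewrite /k; field.
Qed.

End one_variable.

(** The product of the kernels is the product of the independent copies of
[(X - E X) (Y - E Y)], divided by the lengths of the two pairs. *)
Lemma kappa_dichotomous X Y (u v u' v' : R) :
  hker_exists (distribution P X) -> hker_exists (distribution P Y) ->
  dichotomous_at P X u v -> dichotomous_at P Y u' v' ->
  covariance P X Y \is a fin_num /\
  kappa P X Y = ((fine (covariance P X Y)) ^+ 2 / (`|u - v| * `|u' - v'|))%:E.
Proof.
move=> hX hY Xuv Yuv.
have [C1 b1] := centered_RV_bounded Xuv; have [C2 b2] := centered_RV_bounded Yuv.
pose f w := (centered_RV X w * centered_RV Y w)%R.
have fi : P.-integrable setT (EFin \o f).
  apply: (@ae_bounded_integrable _ (C1 * C2)%R).
    by apply: measurable_funM; apply: measurable_funB => //; exact: measurable_RV.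
  by apply: filterS2 b1 b2 => w h1 h2; rewrite /f normrM ler_pM.
have covE : covariance P X Y = \int[P]_w (f w)%:E by rewrite /f /centered_RV !unlock.
split; first by rewrite covE; exact: integrable_fin_num fi.
have [i e] := integral_prod_mul fi fi.
pose k := ((`|u - v| * `|u' - v'|)^-1)%R.
rewrite /kappa (ae_eq_integral (fun w : T * T => k%:E * (f w.1 * f w.2)%:E))//; first last.
- have := ae_square (dichotomous_ae Xuv); have := ae_square (dichotomous_ae Yuv).
  apply: filterS2 => w [y1 y2] [x1 x2] _.
  rewrite /kappa_integrand (hker_dichotomous Xuv)// (hker_dichotomous Yuv)//.
  rewrite -!EFinM; congr EFin; rewrite /f /k /centered_RV invfM.
  by ring.
- by apply: emeasurable_funM => //; exact: measurable_int i.
- exact: measurable_kappa_integrand.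
rewrite integralZl// e -covE -[covariance _ _ _]fineK; last first.
  by rewrite covE; exact: integrable_fin_num fi.
by rewrite -!EFinM; congr EFin; rewrite /k /= -expr2 mulrC.
Qed.

(** The lengths [`|u - v|] and [`|u' - v'|] cancel in the quotient.  When a variance
vanishes, so does the covariance, by the Cauchy-Schwarz inequality for kappa, and
both sides are 0. *)
Lemma rho_star_dichotomous X Y (u v u' v' : R) :
  hker_exists (distribution P X) -> hker_exists (distribution P Y) ->
  dichotomous_at P X u v -> dichotomous_at P Y u' v' ->
  rho_star P X Y = correlation P X Y ^+ 2.
Proof.
move=> hX hY Xuv Yuv.
have [fc kXY] := kappa_dichotomous hX hY Xuv Yuv.
have [fv kXX] := kappa_dichotomous hX hX Xuv Xuv.
have [fw kYY] := kappa_dichotomous hY hY Yuv Yuv.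
have [/= le _] : kappa P X Y <= sqrte (kappa P X X * kappa P Y Y) /\
  (kappa P X Y = sqrte (kappa P X X * kappa P Y Y) <-> linearly_related P X Y).
  by apply: kappa_cauchy_schwarz => //; rewrite ?kXX ?kYY ltry.
have V0 : 0 <= covariance P X X := variance_ge0 P X.
have W0 : 0 <= covariance P Y Y := variance_ge0 P Y.
move: fc fv fw V0 W0 le; rewrite /rho_star /correlation /variance kXY kXX kYY.
case: (covariance P X Y) => [c| |] // _; case: (covariance P X X) => [V| |] // _.
case: (covariance P Y Y) => [W| |] // _; rewrite !lee_fin => V0 W0.
have [uv _] := Xuv; have [uv' _] := Yuv.
have d0 : (0 < `|u - v|)%R by rewrite normr_gt0 subr_eq0.
have d0' : (0 < `|u' - v'|)%R by rewrite normr_gt0 subr_eq0.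
set a : R := `|u - v|%R in d0 *; set b : R := `|u' - v'|%R in d0' *.
rewrite -!EFinM /=.
have -> : (V ^+ 2 / (a * a) * (W ^+ 2 / (b * b)) = (V * W / (a * b)) ^+ 2)%R.
  by field; rewrite !gt_eqF.
rewrite sqrtr_sqr ger0_norm ?divr_ge0 ?mulr_ge0// ?(ltW d0) ?(ltW d0')//.
have [VW|VW] := eqVneq (V * W)%R 0%R.
  rewrite VW mul0r => le.
  have c0 : c = 0%R.
    apply/eqP; rewrite -sqrf_eq0 eq_le sqr_ge0 andbT.
    by move: le; rewrite ler_pdivrMr ?mulr_gt0// mul0r.
  by rewrite sqrtr0 c0 expr0n !mul0r !mul0e.
move=> _; have VWp : (0 < V * W)%R by rewrite lt_def VW mulr_ge0.
have sq0 : (Num.sqrt (V * W) != 0)%R by rewrite gt_eqF// sqrtr_gt0.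
rewrite !inver (negPf sq0) mulf_eq0 (negPf VW) invr_eq0 mulf_eq0 !gt_eqF//=.
rewrite -!EFinM; congr EFin.
have -> : (c / Num.sqrt (V * W) * (c / Num.sqrt (V * W)) = c ^+ 2 / (Num.sqrt (V * W)) ^+ 2)%R.
  by field.
rewrite sqr_sqrtr ?ltW//; field.
by move: VW; rewrite mulf_eq0 negb_or => /andP[-> ->]; rewrite !gt_eqF.
Qed.

End dichotomous.

(** * Order statistics of four values *)

Section order_statistics.
Context (T : Type) (R : realType) (S : 'I_4 -> T -> R) (w : T).
Implicit Types s t m M : R.

Definition below s : {set 'I_4} := [set i | (S i w <= s)%R]%SET.

Lemma below_mono m M : (m <= M)%R -> below m \subset below M.
Proof. by move=> mM; apply/fintype.subsetP => i; rewrite !inE => /le_trans; apply. Qed.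

Lemma order_stat_le k s : (k < 4)%N ->
  (order_stat S k.+1 w <= s)%R = (k < #|below s|)%N.
Proof.
move=> k4; rewrite /order_stat /=; set l := [seq _ | _ <- _].
have cE : count (<= s)%O (sort <=%R l) = #|below s|.
  rewrite count_sort /l enumT count_map /below cardsE cardE /enum_mem size_filter.
  exact: eq_count.
have sl : size (sort <=%R l) = 4%N by rewrite size_sort size_map -cardE card_ord.
have sorted_l : sorted <=%R (sort <=%R l) by apply: sort_sorted; exact: le_total.
have [klt|kge] := ltnP k #|below s|.
  by apply: nth_count_le => //; rewrite cE.
apply/negbTE; rewrite -ltNge; apply: nth_count_gt => //.
by rewrite cE kge sl.
Qed.

(** As a function of [s], the indicator of the interval between the second and the
third order statistic. *)
Lemma middle_gap_card s :
  (step s (order_stat S 2 w) - step s (order_stat S 3 w))%R =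
  (#|below s| == 2)%N%:R.
Proof.
rewrite /step !order_stat_le//.
by case: #|below s| => [|[|[|n]]] /=; rewrite ?subrr ?subr0.
Qed.

Lemma middle_gap_le : (order_stat S 2 w <= order_stat S 3 w)%R.
Proof.
rewrite order_stat_le//; apply: ltnW; rewrite -order_stat_le//.
Qed.

Definition cell m M (A : {set 'I_4}) : Prop :=
  forall i, if i \in A then (S i w <= m)%R else (M < S i w)%R.

Lemma cellE m M (A : {set 'I_4}) : (m <= M)%R ->
  cell m M A <-> (A = below m /\ below m = below M).
Proof.
move=> mM; split => [c|[-> e] i]; last first.
  have := congr1 (fun B : {set 'I_4} => i \in B) e; rewrite !inE => ei.
  by case: ifPn => // n; rewrite ltNge -ei.
have e1 : A = below m.
  apply/setP => i; rewrite inE; have := c i; case: ifPn => _ h; first by rewrite h.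
  by apply/esym/negbTE; rewrite -ltNge (le_lt_trans mM).
split => //; rewrite -e1; apply/setP => i; rewrite inE; have := c i.
by case: ifPn => _ h; [rewrite (le_trans h)|apply/esym/negbTE; rewrite -ltNge].
Qed.

(** Exactly two values are at most [m] and exactly two are at most [M]: since the
first pair is contained in the second one, they are the same, and the remaining
two values exceed [M].  On the right the event is split according to this pair;
the conditions of a single cell bear on one sample value each, as needed to use
independence. *)
Lemma middle_gap_cells m M : (m <= M)%R ->
  ((#|below m| == 2)%N%:R * (#|below M| == 2)%N%:R : R)%R =
  (\sum_(A : {set 'I_4}) (#|A| == 2)%N%:R * (`[< cell m M A >])%:R)%R.
Proof.
move=> mM; rewrite (bigD1 (below m)) //= big1 ?addr0; last first.
  move=> A Am; rewrite (_ : `[< _ >] = false) ?mulr0//.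
  by apply/negbTE/asboolPn => /(cellE _ mM)[/eqP]; rewrite (negbTE Am).
have [e|ne] := eqVneq (below m) (below M).
  have -> : `[< cell m M (below m) >] = true by apply/asboolP/cellE.
  by rewrite -e mulr1; case: (_ == _); rewrite ?mulr1 ?mulr0.
have -> : `[< cell m M (below m) >] = false.
  by apply/negbTE/asboolPn => /(cellE _ mM)[_ /eqP]; rewrite (negbTE ne).
rewrite mulr0; have := below_mono mM; move: ne; rewrite eqEcard.
have [a|] := eqVneq #|below m| 2%N; last by rewrite mul0r.
have [b|] := eqVneq #|below M| 2%N; last by rewrite mulr0.
by rewrite a b leqnn andbT => /negP.
Qed.

End order_statistics.

(** * kappa of a variable with itself *)

Section kappa_order.
Context d (T : measurableType d) (R : realType) (P : probability T R).
Variable Z : {RV P >-> R}.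
Hypothesis hZ : hker_exists (distribution P Z).

Let F s := cdfr (distribution P Z) s.

Lemma joint_cdf_diag s t : joint_cdf Z Z s t = F (Num.min s t).
Proof.
rewrite /joint_cdf /F /cdfr /distribution /pushforward; congr (fine (P _)).
apply/seteqP; split => w /=; rewrite !in_itv /= le_min.
- by move=> [-> ->].
- by move=> /andP.
Qed.

Lemma cdf_gap_diag (p : plane R) :
  cdf_gap Z Z p = (F (Num.min p.1 p.2) * (1 - F (Num.max p.1 p.2)))%R.
Proof.
rewrite /cdf_gap joint_cdf_diag -/(F p.1) -/(F p.2).
by have [_|_] := leP p.1 p.2; ring.
Qed.

(** The integrand is a square, hence nonnegative, so that [gram_eq_ge0] only asks for a
bound on the absolute moments of the joint feature by the gap. *)
Lemma kappa_diag : kappa P Z Z = \int[leb2 R]_p (cdf_gap Z Z p ^+ 2)%:E.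
Proof.
have [f2 gE] := joint_feature_gram hZ hZ.
rewrite -mean_joint_feature /kappa -gE.
apply: (@gram_eq_ge0 _ _ _ _ _ _ _ _ _ _ _ 3%R) => //.
- exact: measurable_joint_feature.
- exact: integrable_joint_feature.
- move=> w; rewrite gE /kappa_integrand rkerE// -EFinM lee_fin -expr2; exact: sqr_ge0.
move=> p; rewrite integral_abs_joint_feature /= mean_joint_feature cdf_gap_diag lee_fin.
rewrite joint_cdf_diag -/(F p.1) -/(F p.2).
(* With [a <= b] the two values of the distribution function, the absolute moment
is [a (1 - b) (1 + 2 (b - a))] and the gap is [a (1 - b)]. *)
have H (a b : R) : (0 <= a)%R -> (a <= b)%R -> (b <= 1)%R ->
    (a * b + a * (1 - 2 * b) * b + (1 - 2 * a) * b * a + (1 - 2 * a) * (1 - 2 * b) * a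
      <= 3 * `|a * (1 - b)|)%R.
  move=> a0 ab b1; rewrite ger0_norm; last by rewrite mulr_ge0// subr_ge0.
  have -> : (a * b + a * (1 - 2 * b) * b + (1 - 2 * a) * b * a + (1 - 2 * a) * (1 - 2 * b) * a
     = (a * (1 - b)) * (1 + 2 * (b - a)))%R by ring.
  by rewrite mulrC; apply: ler_wpM2r; [rewrite mulr_ge0// subr_ge0|lra].
have [F0 F1] : (0 <= F p.1)%R /\ (F p.1 <= 1)%R by apply/andP; exact: cdfr_itv.
have [G0 G1] : (0 <= F p.2)%R /\ (F p.2 <= 1)%R by apply/andP; exact: cdfr_itv.
have [st|/ltW ts] := leP p.1 p.2.
  by apply: H => //; exact: cdfr_mono.
have := H (F p.2) (F p.1) G0 (cdfr_mono _ ts) F1.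
by apply: le_trans; rewrite le_eqVlt; apply/orP; left; apply/eqP; ring.
Qed.

End kappa_order.

(** * The expected squared middle gap *)

Section middle_gap.
Context d (T : measurableType d) (R : realType) (P : probability T R).
Variables (mu : probability R R) (S : 'I_4 -> {RV P >-> R}).
Hypothesis iidS : iid_sample P mu S.

Let Sf : 'I_4 -> T -> R := fun i => S i.
Let F s := cdfr mu s.

Let box (m M : R) (A : {set 'I_4}) (i : 'I_4) : set R :=
  if i \in A then `]-oo, m]%classic else `]M, +oo[%classic.

Let measurable_box m M A i : measurable (box m M A i).
Proof. by rewrite /box; case: ifP => _; exact: measurable_itv. Qed.

Let cells m M A : set T := \bigcap_i (S i @^-1` box m M A i).

Let measurable_cells m M A : measurable (cells m M A).
Proof.
rewrite /cells; apply: fin_bigcap_measurable; first exact: finite_finset.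
by move=> i _; apply: measurable_preimage; exact: measurable_box.
Qed.

Let cellsP m M A w : cells m M A w <-> cell Sf w m M A.
Proof.
split => [c i|c i _].
- by have := c i I; rewrite /box /=; case: ifPn => _ /=; rewrite in_itv /= ?andbT.
- by have := c i; rewrite /box /=; case: ifPn => _ /=; rewrite in_itv /= ?andbT.
Qed.

Let prob_cells m M (A : {set 'I_4}) : #|A| = 2%N ->
  P (cells m M A) = ((F m * (1 - F M)) ^+ 2)%:E.
Proof.
move=> A2; have [law prod] := iidS.
rewrite /cells prod; last by move=> i; exact: measurable_box.
have muM : mu `]M, +oo[%classic = (1 - F M)%:E.
  rewrite -setCitvl probability_setC; last exact: measurable_itv.
  by rewrite EFinB /F /cdfr fineK//; apply: fin_num_measure; exact: measurable_itv.
have mum : mu `]-oo, m]%classic = (F m)%:E.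
  by rewrite /F /cdfr fineK//; apply: fin_num_measure; exact: measurable_itv.
under eq_bigr => i _.
  rewrite [P _](law i _ (measurable_box m M A i)).
  rewrite (_ : mu _ = (if i \in A then F m else 1 - F M)%R%:E); last first.
    by rewrite /box; case: ifP.
  over.
rewrite prodEFin; congr EFin.
rewrite (bigID (mem A)) /=.
rewrite (eq_bigr (fun=> F m)); last by move=> i ->.
rewrite [X in (_ * X)%R](eq_bigr (fun=> 1 - F M)%R); last by move=> i /negbTE ->.
rewrite !prodr_const A2.
have -> : #|[pred i | i \notin A]| = 2%N.
  have := cardC A; rewrite A2 card_ord => e.
  have {e} : #|[predC A]| = 2%N by apply/eqP; rewrite -(eqn_add2l 2) e.
  by apply: etrans; exact: eq_card.
by rewrite exprMn.
Qed.

(** The indicator that [s] separates the two smaller sample values from the two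
larger ones; its integral over [s] is the middle gap. *)
Let b (p : T * line R) : R := (#|below Sf p.1 p.2| == 2)%N%:R.

Let bE w s : b (w, s) = (step s (order_stat Sf 2 w) - step s (order_stat Sf 3 w))%R.
Proof. by rewrite middle_gap_card. Qed.

Let integral_b w : (leb R).-integrable setT (EFin \o (fun s => b (w, s))) /\
  \int[leb R]_s (b (w, s))%:E = (order_stat Sf 3 w - order_stat Sf 2 w)%:E.
Proof.
have E : (fun s => b (w, s)) =
    (fun s => (step s (order_stat Sf 2 w) - step s (order_stat Sf 3 w)) ^+ 2)%R.
  by apply/funext => s; rewrite -bE /b; case: (_ == _); rewrite ?expr1n ?expr0n.
have mE : measurable_fun setT (fun s : line R => b (w, s)).
  rewrite E; apply/measurable_funX/measurable_funB.
  - by have := measurable_section2 (order_stat Sf 2 w) (@measurable_step R).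
  - by have := measurable_section2 (order_stat Sf 3 w) (@measurable_step R).
have I : \int[leb R]_s (b (w, s))%:E = (order_stat Sf 3 w - order_stat Sf 2 w)%:E.
  rewrite (_ : (order_stat _ _ _ - _)%R = `|order_stat Sf 2 w - order_stat Sf 3 w|%R).
    rewrite -integral_sqr_step_sub; apply: eq_integral => s _.
    by have := congr1 (fun g => g s) E => /= ->.
  by rewrite distrC ger0_norm// subr_ge0 middle_gap_le.
split => //; apply/integrableP; split; first exact/measurable_EFinP.
by under eq_integral => s _ do rewrite /= ger0_norm ?ler0n//; rewrite I ltry.
Qed.

(** By [middle_gap_cells] with [m = M = s], [b] is a sum over pairs of indices of
products of steps and complements of steps, which are jointly measurable. *)
Let measurable_b : measurable_fun setT b.
Proof.
have -> : b = (fun p : T * line R => \sum_(A : {set 'I_4}) (#|A| == 2)%N%:R *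
    \prod_(i < 4) (if i \in A then step p.2 (S i p.1) else 1 - step p.2 (S i p.1)))%R.
  apply/funext => p; have h := @middle_gap_cells _ _ Sf p.1 p.2 p.2 (lexx _).
  have -> : b p = (b p * b p)%R by rewrite /b; case: (_ == _); rewrite ?mulr1 ?mulr0.
  rewrite h; apply: eq_bigr => A _; congr (_ * _)%R.
  case: asboolP => [c|nc].
    rewrite big1 // => i _; have := c i; rewrite /step /Sf; case: ifP => _; first by move=> ->.
    by rewrite ltNge => /negbTE ->; rewrite subr0.
  have [i ni] : exists i, ~ (if i \in A then (S i p.1 <= p.2)%R else (p.2 < S i p.1)%R).
    by apply/existsNP.
  rewrite (bigD1 i) //= (_ : (if i \in A then _ else _) = 0%R) ?mul0r//.
  move: ni; rewrite /step; case: ifP => _; first by move/negP/negbTE => ->.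
  by move/negP; rewrite -leNgt => ->; rewrite subrr.
apply: measurable_sum => A; apply: measurable_funM => //.
apply: measurable_prod => i _.
have ms : measurable_fun setT (fun p : T * line R => step p.2 (S i p.1)).
  apply: (measurableT_comp (@measurable_step R)
    (_ : measurable_fun setT (fun p : T * line R => (S i p.1, p.2)))).
  apply: measurable_fun_pair => //.
  exact: (measurableT_comp (measurable_RV (S i)) measurable_fst).
by case: (i \in A) => //; apply: measurable_funB.
Qed.

(** The square of the middle gap is a double integral of [b]; Tonelli's theorem takes
the expectation inside, where the 6 cells attached to pairs of indices have equal
probabilities. *)
Lemma expectation_middle_gap :
  'E_P[fun w => ((order_stat S 2 w - order_stat S 3 w) ^+ 2)%R] =
  \int[leb2 R]_p (6%:R * (F (Num.min p.1 p.2) * (1 - F (Num.max p.1 p.2))) ^+ 2)%:E.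
Proof.
rewrite unlock.
pose Q (q : T * plane R) : \bar R := (b (q.1, q.2.1) * b (q.1, q.2.2))%:E.
have mQ : measurable_fun setT Q.
  apply/measurable_EFinP/measurable_funM.
  - apply: (measurableT_comp measurable_b); apply: measurable_fun_pair => //.
    exact: (measurableT_comp measurable_fst measurable_snd).
  - apply: (measurableT_comp measurable_b); apply: measurable_fun_pair => //.
    exact: (measurableT_comp measurable_snd measurable_snd).
have Q0 q : 0 <= Q q by rewrite lee_fin mulr_ge0// ler0n.
transitivity (\int[P]_w \int[leb2 R]_p Q (w, p)).
  apply: eq_integral => w _; have [i e] := integral_b w.
  have [_] := integral_prod_mul i i.
  rewrite e => e2; apply: (@etrans _ _ ((order_stat Sf 3 w - order_stat Sf 2 w)%:E *
    (order_stat Sf 3 w - order_stat Sf 2 w)%:E)).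
    by rewrite -EFinM; congr EFin; rewrite /Sf; ring.
  by rewrite -e2.
rewrite (@fubini_tonelli _ _ _ _ _ P (leb2 R) Q mQ Q0).
apply: eq_integral => -[s t] _ /=.
set m := Num.min s t; set M := Num.max s t.
have mM : (m <= M)%R by rewrite /m /M; have [] := leP s t => // /ltW.
transitivity (\int[P]_w \sum_(A : {set 'I_4}) ((#|A| == 2)%N%:R%:E * (\1_(cells m M A) w)%:E)).
  apply: eq_integral => w _; rewrite /Q /=.
  have -> : (b (w, s) * b (w, t) = b (w, m) * b (w, M))%R.
    by rewrite /m /M; have [_|_] := leP s t => //; rewrite mulrC.
  rewrite /b /= middle_gap_cells// sumEFin; congr EFin; apply: eq_bigr => A _.
  congr (_ * _)%R; rewrite indicE; congr (_%:R); congr nat_of_bool.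
  by apply/asboolP/idP; rewrite inE => /cellsP.
rewrite ge0_integral_sum//; last first.
  by move=> A; apply: emeasurable_funM => //; apply/measurable_EFinP; exact: measurable_indic.
transitivity (\sum_(A : {set 'I_4}) ((#|A| == 2)%N%:R * (F m * (1 - F M)) ^+ 2)%:E).
  apply: eq_bigr => A _; rewrite ge0_integralZl//; last first.
    by apply/measurable_EFinP; exact: measurable_indic.
  rewrite integral_indic// setIT EFinM.
  by have [A2|_] := eqVneq #|A| 2%N; [congr (_ * _); exact: prob_cells|rewrite !mul0e].
rewrite sumEFin -mulr_suml; congr EFin; congr (_ * _)%R.
rewrite -natr_sum; congr (_%:R).
transitivity (\sum_(A : {set 'I_4} | #|A| == 2) 1)%N.
  by rewrite [RHS]big_mkcond; apply: eq_bigr => A _; case: ifP.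
by rewrite sum1dep_card card_draws card_ord.
Qed.

End middle_gap.

(** * The properties of kappa *)

Lemma kappa_order_stat d (T : measurableType d) (R : realType) (P : probability T R)
    (Z : {RV P >-> R}) d' (T' : measurableType d') (P' : probability T' R)
    (S : 'I_4 -> {RV P' >-> R}) :
  hker_exists (distribution P Z) -> iid_sample P' (distribution P Z) S ->
  kappa P Z Z =
    (6^-1)%:E * 'E_P'[fun w => ((order_stat S 2 w - order_stat S 3 w) ^+ 2)%R].
Proof.
move=> hZ iidS; rewrite (expectation_middle_gap iidS) (kappa_diag hZ).
under [in RHS]eq_integral => p _ do rewrite -cdf_gap_diag EFinM.
rewrite (integralZl_ge0 _ (measurable_sqr_cdf_gap Z Z))//.
by rewrite muleA -EFinM mulVf// mul1e.
Qed.
Theorem theorem2 (R : realType) (d : measure_display) (T : measurableType d)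
    (P : probability T R) (X Y Z : {RV P >-> R})
    (hX : hker_exists (distribution P X))
    (hY : hker_exists (distribution P Y))
    (hZ : hker_exists (distribution P Z)) :
  [/\ (forall a b c e : R,
         kappa P (affine a b X) (affine c e Y) = (`|a| * `|c|)%:E * kappa P X Y /\
         (a != 0%R -> c != 0%R ->
           rho_star P (affine a b X) (affine c e Y) = rho_star P X Y)),
      ((kappa_defined P X Y -> 0 <= kappa P X Y) /\
       (kappa P X Y = 0 <-> independent2 P X Y)),
      (kappa P X X < +oo -> kappa P Y Y < +oo ->
         kappa P X Y <= sqrte (kappa P X X * kappa P Y Y) /\
         (kappa P X Y = sqrte (kappa P X X * kappa P Y Y) <->
           linearly_related P X Y)),
      (forall u v u' v' : R, dichotomous_at P X u v -> dichotomous_at P Y u' v' ->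
         [/\ (`|u - v| * `|u' - v'|)%:E * kappa P X Y = covariance P X Y ^+ 2,
             (`|u - v|%R = 1%R -> `|u' - v'|%R = 1%R ->
               kappa P X Y = covariance P X Y ^+ 2)
           & rho_star P X Y = correlation P X Y ^+ 2]) &
      (forall (d' : measure_display) (T' : measurableType d')
          (P' : probability T' R) (S : 'I_4 -> {RV P' >-> R}),
         iid_sample P' (distribution P Z) S ->
         kappa P Z Z =
           (6^-1)%:E *
           'E_P'[fun w => ((order_stat S 2 w - order_stat S 3 w) ^+ 2)%R])].
Proof.
split.
- move=> a b c e; split; first exact: kappa_affine.
  by move=> a0 c0; exact: rho_star_affine.
- split; first exact: kappa_defined_ge0.
  by split; [exact: kappa0_indep|exact: indep_kappa0].
- by move=> finX finY; exact: kappa_cauchy_schwarz.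
- move=> u v u' v' Xuv Yuv.
  have [fincov ->] := kappa_dichotomous hX hY Xuv Yuv.
  have [uv uv'] : (`|u - v| != 0)%R /\ (`|u' - v'| != 0)%R.
    by rewrite !normr_eq0 !subr_eq0; split; [case: Xuv|case: Yuv].
  split; last exact: (rho_star_dichotomous hX hY Xuv Yuv).
  + by rewrite -EFinM mulrCA divff ?mulf_neq0// mulr1 EFin_expe fineK.
  + by move=> -> ->; rewrite mulr1 divr1 EFin_expe fineK.
- by move=> d' T' P' S; exact: kappa_order_stat.
Qed.
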